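(* For any finite loose graph $\Gamma$, the $\mathbb Z$-scheme $\chi:=\mathcal F(\Gamma)\otimes_{\mathbb F_1}\mathbb Z$ is defined over $\mathbb F_1$ in Kurokawa's sense.
   Context: A loose graph is a triple $(V,E,\mathbf I)$ of vertices, edges and a symmetric incidence relation between vertices and edges such that each edge is incident with at most two distinct vertices (so an edge may have two, one or no vertices); no loops, undirected. The degree $\deg(v)$ is the number of edges incident with $v$. Ambient space: let $\overline\Gamma$ be the graph obtained from $\Gamma$ by adding a second, new vertex to each edge having only one vertex (and two new vertices to each edge having none), with vertex set $\overline V$; $\mathbf P(\Gamma)$ is the projective space with one homogeneous coordinate $X_w$ for each $w\in\overline V$ (over $\mathbb F_1$, $\mathbb Z$, or a field). The functor $\mathcal F$: for $v\in V$ let $\mathbb A_v\subset\mathbf P(\Gamma)$ be the affine space of dimension $\deg(v)$ given by $X_v\ne0$ and $X_w=0$ for every $w\in\overline V\setminus\{v\}$ not adjacent to $v$ in $\overline\Gamma$; an edge with no vertices, with added ends $a,b$, gives the multiplicative group $X_aX_b\neq 0$, all other coordinates $0$. $\mathcal F(\Gamma)$ is the union of all these (constructible) pieces inside $\mathbf P(\Gamma)$ over $\mathbb F_1$, and $\mathcal F(\Gamma)\otimes_{\mathbb F_1}R$, for $R=\mathbb Z$ or a field, is the corresponding union inside $\mathbf P(\Gamma)$ over $R$. A $\mathbb Z$-scheme $X$ is defined over $\mathbb F_1$ in Kurokawa's sense if its arithmetic zeta function has the form $\zeta_X(s)=\prod_{k=0}^n\zeta(s-k)^{a_k}$ with $a_k\in\mathbb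 Z$ ($\zeta$ the Riemann zeta function); by Kurokawa this is equivalent to the existence of a polynomial $P_X(Y)=\sum_{k=0}^n a_kY^k\in\mathbb Z[Y]$ with $\#X(\mathbb F_{p^m})=P_X(p^m)$ for all finite fields $\mathbb F_{p^m}$. *)

(* Defs.v *)
(* [mpoly] has to be loaded before the analysis libraries: in the other order
   their notation levels clash. *)
From HB Require Import structures.
From mathcomp Require Import all_boot all_order all_algebra.
From mathcomp Require Import ring_quotient complex mpoly.
From mathcomp Require Import all_classical all_reals all_analysis.
Set Implicit Arguments.
Unset Strict Implicit.
Unset Printing Implicit Defensive.

Import Order.TTheory GRing.Theory Num.Theory.
Import numFieldNormedType.Exports.
Local Open Scope classical_set_scope.
Local Open Scope ring_scope.
Local Open Scope card_scope.
Local Open Scope complex_scope.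

(* Incidence is symmetric, so only its vertex-to-edge half is recorded. *)
Record loose_graph := LooseGraph {
  vertex : finType;
  edge : finType;
  incident : vertex -> edge -> bool;
  incident_le2 : forall e, (#|[pred v | incident v e]| <= 2)%N }.

Section Completion.
Variable G : loose_graph.

Definition nb_ends (e : edge G) : nat := #|[pred v | incident v e]|.

(* The vertices of the completed graph: those of G, together with
   2 - nb_ends e new vertices on every edge e. *)
Definition cvertex : finType := (vertex G + {e : edge G & 'I_(2 - nb_ends e)})%type.

Definition cincident (w : cvertex) (e : edge G) : bool :=
  match w with
  | inl v => incident v e
  | inr t => tag t == e
  end.

Definition cadjacent (w w' : cvertex) : bool :=
  (w != w') && [exists e, cincident w e && cincident w' e].

End Completion.

Section Proj.
Variable n : nat.

(* Points of Proj Z[X_0, ..., X_(n-1)]: the homogeneous prime ideals not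
   containing all the variables ([idealr_closed] includes properness). *)
Definition is_proj_point (P : set {mpoly int[n]}) : Prop :=
  [/\ idealr_closed (mem P),
      prime_idealr_closed (mem P),
      forall f d, P f -> P (pihomog mdeg d f) &
      exists i : 'I_n, ~ P 'X_i].

(* The residue field at P, whose elements are the fractions u.1 / u.2 of
   homogeneous forms of the same degree with u.2 outside P, taken modulo P. *)
Definition hfrac (P : set {mpoly int[n]}) : set ({mpoly int[n]} * {mpoly int[n]}) :=
  [set u | ~ P u.2 /\ exists d, u.1 \is d.-homog /\ u.2 \is d.-homog].

Definition hfrac_class (P : set {mpoly int[n]}) (u : {mpoly int[n]} * {mpoly int[n]}) :
    set ({mpoly int[n]} * {mpoly int[n]}) :=
  [set u' | hfrac P u' /\ P (u'.1 * u.2 - u.1 * u'.2)].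

Definition residue_field (P : set {mpoly int[n]}) :
    set (set ({mpoly int[n]} * {mpoly int[n]})) :=
  hfrac_class P @` hfrac P.

(* The closed points of a subspace X of Proj with residue field of cardinality
   q; a point P' lies in the closure of P exactly when P is included in P'. *)
Definition closed_points_of_norm (X : set (set {mpoly int[n]})) (q : nat) :
    set (set {mpoly int[n]}) :=
  [set P | [/\ X P, (forall P', X P' -> P `<=` P' -> P' = P) &
               residue_field P #= `I_q]].

End Proj.

Section Scheme.
Variable G : loose_graph.

Definition coordX (w : cvertex G) : {mpoly int[#|cvertex G|]} := 'X_(enum_rank w).

Definition vertex_piece (v : vertex G) : set (set {mpoly int[#|cvertex G|]}) :=
  [set P | [/\ is_proj_point P, ~ P (coordX (inl v)) &
     forall w, w != inl v -> ~~ cadjacent w (inl v) -> P (coordX w)]].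

(* Used for an edge e without vertices, whose two ends are both new; as P is
   prime, X_a X_b is outside P iff X_a and X_b both are. *)
Definition edge_piece (e : edge G) : set (set {mpoly int[#|cvertex G|]}) :=
  [set P | [/\ is_proj_point P,
     forall w, cincident w e -> ~ P (coordX w) &
     forall w, ~~ cincident w e -> P (coordX w)]].

Definition loose_scheme : set (set {mpoly int[#|cvertex G|]}) :=
  (\bigcup_(v in [set: vertex G]) vertex_piece v) `|`
  (\bigcup_(e in [set e : edge G | nb_ends e = 0%N]) edge_piece e).

End Scheme.

Arguments loose_scheme G : clear implicits.

Section Zeta.
Variable R : realType.

Definition cexp (z : R[i]) : R[i] :=
  (expR (complex.Re z))%:C * (cos (complex.Im z) +i* sin (complex.Im z)).

(* n ^ s for n > 0 *)
Definition npow (n : nat) (s : R[i]) : R[i] := cexp ((ln (n%:R : R))%:C * s).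

(* Meant for Re s > 1, where the series converges. *)
Definition riemann_zeta (s : R[i]) : R[i] :=
  limn (series (fun n : nat => npow n.+1 (- s)) : nat -> R[i]^o).

(* The product of (1 - N(x) ^ (-s))^-1 over the closed points x of X, ordered
   by increasing N(x), converges to z. Closed points are grouped by norm: there
   are B q of them (in particular finitely many) of norm q. *)
Definition arithmetic_zeta (n : nat) (X : set (set {mpoly int[n]}))
    (s z : R[i]) : Prop :=
  exists2 B : nat -> nat,
    forall q, closed_points_of_norm X q #= `I_(B q) &
    (fun Q : nat => (\prod_(2 <= q < Q.+1) (1 - npow q (- s)) ^- (B q) : R[i]^o))
      @ \oo --> (z : R[i]^o).

(* Equality of zeta functions is equality on the half-plane Re s > m + 1, where
   all the zeta (s - k) are given by their series; both sides being meromorphic,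
   this determines them. *)
Definition defined_over_F1 (n : nat) (X : set (set {mpoly int[n]})) : Prop :=
  exists (m : nat) (a : 'I_m.+1 -> int), forall s : R[i],
    m.+1%:R < complex.Re s ->
    arithmetic_zeta X s (\prod_(k < m.+1) riemann_zeta (s - (k : nat)%:R) ^ (a k)).

End Zeta.

(* Main.v *)
(** A point of Proj is sorted by its support, the set of coordinates that do not
    vanish at it, and the pieces of the scheme are unions of the strata with
    supports in a finite family. The stratum of support [S] is a torus with
    [(q - 1) ^ (|S| - 1)] points over the field with [q] elements, so that the
    number of points is a polynomial [\sum_k a_k q ^ k].

    A closed point whose residue field has [p ^ d] elements, with [d] dividing
    [m], is a Frobenius orbit of size [d] among the points over the field with
    [p ^ m] elements. The numbers [B] of closed points by norm thus satisfy
    [\sum_(d | m) d * B (p ^ d) = \sum_k a_k p ^ (k * m)], which says that the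
    logarithm of the Euler product of the scheme is the combination with
    coefficients [a_k] of the logarithms of the Euler products of the
    [zeta (s - k)].

    No complex logarithm is used: the identity is applied to the sums
    [\sum_(n < N) z ^ n / n] cut off at [q ^ n <= Q], and the elementary factors
    [(1 - z) exp (\sum_(n < N) z ^ n / n) = 1 + O(z ^ N)] have a product that
    tends to 1 as [Q] goes to infinity. *)

Require Import Defs.
From HB Require Import structures.
From mathcomp Require Import all_boot all_order all_algebra all_field.
From mathcomp Require cyclic.
From mathcomp Require Import ring_quotient complex mpoly.
From mathcomp Require Import all_classical all_reals all_analysis.
From mathcomp Require Import ring lra.
Set Implicit Arguments.
Unset Strict Implicit.
Unset Printing Implicit Defensive.

Import Order.TTheory GRing.Theory Num.Theory.
Import numFieldNormedType.Exports.
Local Open Scope classical_set_scope.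
Local Open Scope ring_scope.

(** * Finite fields and integer polynomials *)

(** A residue field is given only as a set of classes, known by its cardinality, with no embedding
    into the fields used for counting. The comparison rests instead on having the same vanishing
    polynomials with integer coefficients. A finite residue field is rebuilt as a quotient of an
    integer polynomial ring; its elements are integer polynomials in one generator of the
    multiplicative group, and this generator is carried to another field of the same characteristic
    through an integer lift of its minimal polynomial. On the analytic side, for [q = p ^ d] the
    cutoff [q ^ n <= Q] reads [p ^ (d * n) <= Q], a condition on [m = d * n] alone. The
    rearrangement is therefore an exact identity of finite sums at each [Q], and no double series is
    rearranged. What remains is that the Euler products of the [zeta (s - k)] converge to nonzero
    limits, which comes from sieving the Dirichlet series. *)

Lemma quotient_finField (R : comNzRingType) (T : finType) (I : {pred R})
    (c : R -> T) :
  idealr_closed I -> prime_idealr_closed I ->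
  (forall a b, c a = c b -> a - b \in I) ->
  exists (K : finFieldType) (psi : {rmorphism R -> K}),
    (forall k, exists f, psi f = k) /\ forall f, (psi f == 0) = (f \in I).
Proof.
move=> idI prI cI.
pose I1 := HB.pack_for (idealr R) (I : R -> bool) (isIdealr.Build R I idI).
pose D := {ideal_quot I1}.
have piI f : ((\pi_D f)%qT == 0 :> D) = (f \in I).
  by rewrite -[0 in LHS](rmorph0 (\pi_D)%qT) -Quotient.idealrBE subr0.
have domD (x y : D) : x * y = 0 -> (x == 0) || (y == 0).
  move=> /eqP; by rewrite -[x]reprK -[y]reprK -rmorphM !piI; exact: prI.
(* Sending a class to the value of [c] at its representative is injective; through the left inverse
   [g] the quotient inherits finiteness from [T]. *)
pose g (t : T) : D := xget 0 [set x : D | c (generic_quotient.repr x) = t].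
have gK : cancel (fun x : D => c (generic_quotient.repr x)) g.
  move=> x; rewrite /g; case: xgetP => [y _ /= /cI h|h]; last by case: (h x).
  rewrite -[LHS]reprK -[RHS]reprK; apply/eqP; rewrite -Quotient.idealrBE -opprB.
  by rewrite -opprB opprK.
pose Dc := HB.pack_for countType D (CanIsCountable gK).
pose gKc : @cancel T Dc _ g := gK.
pose inv (x : D) : D := xget 0 [set y | y * x = 1].
have inv0 : inv 0 = 0.
  rewrite /inv; case: xgetP => // y _ /eqP; rewrite mulr0 eq_sym.
  by rewrite oner_eq0.
pose Df := HB.pack_for finType D (CanIsCountable gK) (CanIsFinite gKc).
(* A finite domain is a field: multiplication by [x] is injective, hence reaches 1. *)
have mulVD (x : D) : x != 0 -> inv x * x = 1.
  move=> x0; rewrite /inv; case: xgetP => // h; exfalso.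
  have inj : injective (fun y : Df => (y : D) * x : Df).
    move=> y z /eqP; rewrite -subr_eq0 -mulrBl => /eqP /domD.
    by rewrite (negPf x0) orbF subr_eq0 => /eqP.
  have [i _ iK] := injF_bij inj.
  by apply: (h (i (1 : D))); exact: iK.
pose K := HB.pack_for finFieldType D (CanIsCountable gK) (CanIsFinite gKc)
  (GRing.ComNzRing_isField.Build D mulVD inv0).
pose psi : {rmorphism R -> D} := (\pi_D)%qT.
exists K, psi; split => [k|f]; last exact: piI.
by exists (generic_quotient.repr (k : D)); exact: (reprK (k : D)).
Qed.

Lemma intr_eq0_pchar (R S : nzRingType) p (z : int) :
  p \in [pchar R] -> p \in [pchar S] -> (z%:~R == 0 :> R) = (z%:~R == 0 :> S).
Proof.
move=> pR pS; rewrite [z]intEsign !rmorphM /= !rmorph_sign !mulr_sign.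
have e (Q : nzRingType) : p \in [pchar Q] ->
    (`|z|%N%:~R == 0 :> Q) = (p %| `|z|)%N.
  by move=> pQ; rewrite -pmulrn -(dvdn_pcharf pQ).
by case: (z < 0); rewrite ?oppr_eq0 !e.
Qed.

Lemma map_poly_intr_eq0 (R S : nzRingType) p (W : {poly int}) :
  p \in [pchar R] -> p \in [pchar S] ->
  (map_poly intr W == 0 :> {poly R}) = (map_poly intr W == 0 :> {poly S}).
Proof.
move=> pR pS.
have e (Q Q' : nzRingType) : p \in [pchar Q] -> p \in [pchar Q'] ->
   map_poly intr W == 0 :> {poly Q} -> map_poly intr W == 0 :> {poly Q'}.
  move=> pQ pQ' /eqP h; apply/eqP/polyP => i; apply/eqP.
  rewrite coef_map coef0 /= (intr_eq0_pchar _ pQ' pQ).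
  by have := congr1 (fun q : {poly Q} => q`_i) h; rewrite coef_map coef0 /= => ->.
by apply/idP/idP; exact: e.
Qed.

(** The images of [0, ..., p - 1] are already [p] distinct roots of ['X^p - 'X], whose degree leaves
    no room for another. *)
Lemma Frobenius_fixed (F : finFieldType) p (a : F) :
  p \in [pchar F] -> a ^+ p = a -> exists n : nat, a = n%:R.
Proof.
move=> pF ap; have pr := pcharf_prime pF.
pose s : seq F := [seq n%:R | n <- iota 0 p].
have us : uniq s.
  rewrite map_inj_in_uniq ?iota_uniq// => i j; rewrite !mem_iota /= !add0n => ip jp.
  wlog ij : i j ip jp / (i <= j)%N.
    by move=> h; case: (leqP i j) => [|/ltnW] ij e; [exact: h|symmetry; exact: h].
  move=> /eqP; rewrite eq_sym -subr_eq0 -natrB// -(dvdn_pcharf pF) => pd.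
  have : (j - i == 0)%N.
    apply: contraTT pd; rewrite -lt0n => ?; rewrite gtnNdvd//.
    by rewrite (leq_ltn_trans _ jp)// leq_subr.
  by rewrite subn_eq0 => ji; apply/eqP; rewrite eqn_leq ij.
pose q : {poly F} := 'X^p - 'X.
have sz : size q = p.+1.
  by rewrite /q size_polyDl size_polyXn// size_polyN size_polyX ltnS prime_gt1.
have [/mapP[n _ ->]|aNs] := boolP (a \in s); first by exists n.
suff : (size (a :: s) < size q)%N.
  by rewrite sz /= size_map size_iota ltnn.
apply: max_poly_roots.
- by rewrite -size_poly_gt0 sz.
- rewrite /= rootE /q !hornerE ap subrr eqxx /=.
  apply/allP => _ /mapP[n _ ->].
  by rewrite rootE /q !hornerE -(pFrobenius_autE pF) pFrobenius_aut_nat subrr.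
- by rewrite /= aNs.
Qed.

Lemma Frobenius_inj (F : finFieldType) p : p \in [pchar F] ->
  injective (fun x : F => x ^+ p).
Proof. by move=> pF x y; rewrite -!(pFrobenius_autE pF); apply: fmorph_inj. Qed.

Definition Frobenius (F : finFieldType) p (x : F) := x ^+ p.

(** Frobenius permutes the roots of the product, so its coefficients lie in the prime field and lift
    to integers. *)
Lemma orbit_polynomial (F : finFieldType) p (g : F) : p \in [pchar F] ->
  exists2 R : {poly int}, R \is monic &
    map_poly intr R = \prod_(a <- orbit (Frobenius p) g) ('X - a%:P) :> {poly F}.
Proof.
move=> pF; set Q := \prod_(a <- _) _.
have Qfix : map_poly (pFrobenius_aut pF) Q = Q.
  rewrite rmorph_prod /=.
  under eq_bigr do rewrite rmorphB /= map_polyX map_polyC /=.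
  rewrite -(big_map (pFrobenius_aut pF) xpredT (fun a => 'X - a%:P)).
  apply: perm_big; apply: uniq_perm => [||x].
  - by rewrite (map_inj_uniq (fmorph_inj _)) orbit_uniq.
  - exact: orbit_uniq.
  have injf : injective (@Frobenius F p) := Frobenius_inj pF.
  apply/mapP/idP => [[y yg ->]|xg].
    by rewrite -fconnect_orbit (connect_trans _ (fconnect1 _ _)) ?fconnect_orbit.
  exists (finv (Frobenius p) x); last by rewrite pFrobenius_autE -[_ ^+ p]/(Frobenius p _) f_finv.
  by rewrite -fconnect_orbit (connect_trans _ (fconnect_finv _ _)) ?fconnect_orbit.
have Qn i : exists n : nat, Q`_i = n%:R.
  apply: (Frobenius_fixed pF).
  by have := congr1 (fun q : {poly F} => q`_i) Qfix; rewrite coef_map /= pFrobenius_autE.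
have [c cE] := choice Qn.
have Qm : Q \is monic by rewrite monic_prod // => a _; exact: monicXsubC.
pose d := (size Q).-1.
have sQ : size Q = d.+1 by rewrite prednK// size_poly_gt0 monic_neq0.
(* The leading coefficient is set to 1 by hand, since [c d] is only known to be 1 in [F]; a monic
   lift permits division with remainder over the integers. *)
pose R : {poly int} := \poly_(i < d) (c i)%:Z + 'X^d.
have sR : (size (\poly_(i < d) (c i)%:Z : {poly int}) <= d)%N by exact: size_poly.
exists R.
  rewrite monicE /R addrC lead_coefDl ?lead_coefXn//.
  by rewrite size_polyXn ltnS.
apply/polyP => i; rewrite /R rmorphD /= map_polyXn coefD coef_map coef_poly coefXn.
case: ltnP => [id|].
  by rewrite ltn_eqF// addr0 cE.
rewrite leq_eqVlt => /orP[/eqP <-|di].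
  rewrite eqxx ?mulr0z ?rmorph0 add0r; by rewrite monicE in Qm; rewrite -(eqP Qm).
by rewrite gtn_eqF// ?mulr0z ?rmorph0 addr0 nth_default// sQ.
Qed.

(* [R] lifts to the integers the minimal polynomial of [g], so that divisibility
   by it can be transported to any other [L] of characteristic [p]. *)
Lemma orbit_polynomial_min (F : finFieldType) p (g : F) (R S : {poly int}) :
  p \in [pchar F] -> R \is monic ->
  map_poly intr R = \prod_(a <- orbit (Frobenius p) g) ('X - a%:P) :> {poly F} ->
  (map_poly intr S).[g] = 0 :> F ->
  forall (L : nzRingType), p \in [pchar L] ->
    map_poly intr (Pdiv.Ring.rmodp S R) = 0 :> {poly L}.
Proof.
move=> pF Rm RE Sg L pL; apply/eqP; rewrite (map_poly_intr_eq0 _ pL pF).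
have SE := congr1 (map_poly (intr : int -> F)) (Pdiv.RingMonic.rdivp_eq Rm S).
have aF (x : F) T : (map_poly intr T).[x ^+ p] = (map_poly intr T).[x] ^+ p :> F.
  rewrite -!(pFrobenius_autE pF) -horner_map /= -map_poly_comp /=.
  by congr (_.[_]); apply: eq_map_poly => z /=; rewrite rmorph_int.
have Sa a : a \in orbit (Frobenius p) g -> (map_poly intr S).[a] = 0 :> F.
  rewrite -fconnect_orbit => /iter_findex <-.
  elim: findex => //= n IH; rewrite aF IH expr0n.
  by rewrite gtn_eqF// prime_gt0// (pcharf_prime pF).
apply: contraT => W0.
have : (size (orbit (Frobenius p) g) < size (map_poly intr (Pdiv.Ring.rmodp S R) : {poly F}))%N.
  apply: max_poly_roots => //; last exact: orbit_uniq.
  apply/allP => a ag; have := Sa _ ag.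
  rewrite SE rmorphD rmorphM /= RE hornerD hornerM => /eqP.
  suff -> : (\prod_(a <- orbit (Frobenius p) g) ('X - a%:P)).[a] = 0 by rewrite mulr0 add0r.
  by apply/eqP; rewrite -rootE root_prod_XsubC.
rewrite ltnNge => /negP[].
have : (size (map_poly intr R : {poly F}) = (size (orbit (Frobenius p) g)).+1)%N.
  by rewrite RE size_prod_XsubC.
rewrite (size_map_poly_id0) ?(monicP Rm) ?rmorph1 ?oner_neq0// => sR.
have := Pdiv.Ring.ltn_rmodp S R; rewrite (monic_neq0 Rm) sR ltnS => h.
by apply: (leq_trans (size_poly _ _)).
Qed.

Definition zhorner (L : nzRingType) (g : L) (S : {poly int}) : L := (map_poly intr S).[g].

(** As [d] divides [m], [g] is a root of ['X^(p ^ m) - 'X], which its minimal polynomial therefore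
    divides in characteristic [p]. Over [F] the former splits, so the latter has a root [h]
    there. *)
Lemma conjugate_exists (K F : finFieldType) p d m (g : K) :
  p \in [pchar K] -> p \in [pchar F] -> #|K| = (p ^ d)%N -> #|F| = (p ^ m)%N ->
  (0 < m)%N -> (d %| m)%N ->
  exists h : F, forall S : {poly int}, (zhorner g S == 0) = (zhorner h S == 0).
Proof.
move=> pK pF cK cF m0 dm.
have [R Rm RE] := orbit_polynomial g pK.
have p1 : (1 < p)%N by rewrite prime_gt1// (pcharf_prime pK).
have gpm : g ^+ (p ^ m) = g.
  case/dvdnP: dm => k ->; elim: k => [|k IH]; first by rewrite mul0n expr1.
  by rewrite mulSn expnD exprM -cK expf_card IH.
pose S0 : {poly int} := 'X^(p ^ m) - 'X.
have S0E (L : nzRingType) : map_poly intr S0 = 'X^(p ^ m) - 'X :> {poly L}.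
  by rewrite rmorphB /= map_polyXn map_polyX.
have S0g : zhorner g S0 = 0 by rewrite /zhorner S0E !hornerE gpm subrr.
have dvd : map_poly intr R %| ('X^(p ^ m) - 'X : {poly F}).
  rewrite -(S0E F) (Pdiv.RingMonic.rdivp_eq Rm S0) rmorphD rmorphM /=.
  by rewrite (orbit_polynomial_min pK Rm RE S0g pF) addr0 dvdp_mull.
have Rs : size (map_poly intr R : {poly F}) != 1%N.
  have -> : size (map_poly intr R : {poly F}) = size R.
    by rewrite size_map_poly_id0// (monicP Rm) rmorph1 oner_neq0.
  have := congr1 (fun q : {poly K} => size q) RE; rewrite size_prod_XsubC.
  rewrite size_map_poly_id0 ?(monicP Rm) ?rmorph1 ?oner_neq0// => ->.
  by rewrite eqSS -lt0n size_orbit order_gt0.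
have [h hR] : exists h : F, (map_poly intr R).[h] = 0.
  move: dvd; rewrite -cF finField_genPoly => /dvdp_prod_XsubC[ms].
  set r := mask _ _ => Rr.
  have : r != [::].
    apply: contraNneq Rs => r0; have := eqp_size Rr; rewrite r0 big_nil size_poly1.
    by move=> ->.
  case: r Rr => // h r Rr _; exists h; apply/eqP.
  by rewrite -rootE (eqp_root Rr) root_prod_XsubC mem_head.
have gh S : zhorner g S = 0 -> zhorner h S = 0.
  move=> Sg; rewrite /zhorner (Pdiv.RingMonic.rdivp_eq Rm S) rmorphD rmorphM /=.
  by rewrite (orbit_polynomial_min pK Rm RE Sg pF) addr0 hornerM hR mulr0.
exists h => S; apply/eqP/eqP; first exact: gh.
move=> Sh; apply/eqP; apply: contraT => Sg0.
(* By Fermat, not vanishing at [g] amounts to the vanishing of [T] at [g], which passes to [h] by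
   the implication already proved. *)
pose T := S ^+ #|K|.-1 - 1.
have cK1 : (1 < #|K|)%N by exact: card_finNzRing_gt1.
have : zhorner g T = 0.
  rewrite /zhorner /T rmorphB rmorphXn /= rmorph1 !hornerE; apply/eqP.
  rewrite subr_eq0; apply/eqP; apply: (mulfI Sg0); rewrite mulr1 -exprS prednK.
    exact: expf_card.
  exact: ltn_trans cK1.
move/gh/eqP; rewrite /zhorner /T rmorphB rmorphXn /= rmorph1 !hornerE.
have -> : (map_poly intr S).[h] = 0 := Sh.
by rewrite expr0n gtn_eqF -?subn1 ?subn_gt0// sub0r oppr_eq0 oner_eq0.
Qed.

Lemma conjugate_orbit (F : finFieldType) p (g h : F) : p \in [pchar F] ->
  (forall S : {poly int}, zhorner g S = 0 -> zhorner h S = 0) ->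
  exists i, h = iter i (Frobenius p) g.
Proof.
move=> pF gh; have [R Rm RE] := orbit_polynomial g pF.
have : zhorner h R = 0.
  by apply: gh; apply/eqP; rewrite /zhorner RE -rootE root_prod_XsubC -fconnect_orbit.
move/eqP; rewrite /zhorner RE -rootE root_prod_XsubC -fconnect_orbit => /iter_findex <-.
by eexists.
Qed.

(** All the coordinates of a point become integer polynomials in one element, which reduces
    statements on tuples to statements on [g]. *)
Lemma primitive_element (K : finFieldType) :
  exists g : K, forall x, x != 0 -> exists e, x = g ^+ e.
Proof.
pose s := enum (predC1 (0 : K)).
have cs : size s = #|K|.-1 by rewrite -cardE cardC1.
have c0 : (0 < #|K|.-1)%N by rewrite -subn1 subn_gt0 card_finNzRing_gt1.
have x1 (x : K) : x != 0 -> x ^+ #|K|.-1 = 1.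
  move=> x0; apply: (mulfI x0); rewrite mulr1 -exprS prednK ?expf_card//.
  by rewrite (ltn_trans _ (card_finNzRing_gt1 K)).
have /hasP[g _ pg] : has #|K|.-1.-primitive_root s.
  apply: cyclic.has_prim_root; rewrite ?cs ?enum_uniq//.
  by apply/allP => x; rewrite mem_enum inE => x0; rewrite unity_rootE x1.
exists g => x /x1 /(prim_rootP pg)[e ->].
by exists e.
Qed.

Lemma rmorph_mmap n (R : nzRingType) (S T : comNzRingType) (u : {rmorphism S -> T})
    (f : {rmorphism R -> S}) (h : 'I_n -> S) (q : {mpoly R[n]}) :
  u (mmap f h q) = mmap (u \o f) (u \o h) q.
Proof.
rewrite /mmap rmorph_sum /=; apply: eq_bigr => m _.
rewrite rmorphM /=; congr (_ * _); rewrite /mmap1 rmorph_prod /=.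
by apply: eq_bigr => i _; rewrite rmorphXn.
Qed.

Definition zmeval n (L : comNzRingType) (x : 'I_n -> L) : {mpoly int[n]} -> L := mmap intr x.
HB.instance Definition _ n L x := GRing.RMorphism.copy (@zmeval n L x) (mmap intr x).
HB.instance Definition _ (L : comNzRingType) (g : L) := GRing.RMorphism.copy (zhorner g)
  (horner_eval g \o map_poly intr).

Lemma zmevalX n (L : comNzRingType) (x : 'I_n -> L) i : zmeval x 'X_i = x i.
Proof. by rewrite /zmeval mmapX mmap1U. Qed.

Lemma eq_zmeval n (L : comNzRingType) (x y : 'I_n -> L) : x =1 y -> zmeval x =1 zmeval y.
Proof. by move=> xy f; congr (mmap _ _ f); apply/funext. Qed.

Lemma rmorph_zhorner (L M : comNzRingType) (u : {rmorphism L -> M}) (g : L) S :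
  u (zhorner g S) = zhorner (u g) S.
Proof.
rewrite /zhorner -horner_map -map_poly_comp /=; congr (_.[_]).
by apply: eq_map_poly => z /=; rewrite rmorph_int.
Qed.

Lemma rmorph_zmeval n (L M : comNzRingType) (u : {rmorphism L -> M}) (x : 'I_n -> L) f :
  u (zmeval x f) = zmeval (u \o x) f.
Proof.
rewrite /zmeval [LHS]rmorph_mmap; congr (mmap _ _ f); apply/funext => z /=.
exact: rmorph_int.
Qed.

Lemma zmeval_transfer n (K F : finFieldType) p d m (x : 'I_n -> K) :
  p \in [pchar K] -> p \in [pchar F] -> #|K| = (p ^ d)%N -> #|F| = (p ^ m)%N ->
  (0 < m)%N -> (d %| m)%N ->
  exists y : 'I_n -> F, forall f, (zmeval x f == 0) = (zmeval y f == 0).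
Proof.
move=> pK pF cK cF m0 dm.
have [g gP] := primitive_element K.
have [h hP] := conjugate_exists g pK pF cK cF m0 dm.
have xS j : exists S : {poly int}, x j = zhorner g S.
  have [->|/gP[e ->]] := eqVneq (x j) 0; first by exists 0; rewrite rmorph0.
  by exists 'X^e; rewrite /zhorner map_polyXn !hornerE.
have [S SE] := choice xS.
exists (zhorner h \o S) => f.
rewrite -(rmorph_zmeval (zhorner h)) -hP (rmorph_zmeval (zhorner g)).
by rewrite (@eq_zmeval _ _ _ (zhorner g \o S)).
Qed.

(** The field generated by the coordinates [x] is realised as a quotient of the polynomial ring. If
    [c] maps to a generator of its multiplicative group, every variable is an integer polynomial in
    [c] modulo the kernel. These expressions hold at [y] as well, so it suffices that the values of
    [c] at [x] and [y] be conjugate. *)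
Lemma zmeval_conjugate n (F : finFieldType) p (x y : 'I_n -> F) : p \in [pchar F] ->
  (forall f, zmeval x f = 0 -> zmeval y f = 0) ->
  exists i, forall j, y j = iter i (Frobenius p) (x j).
Proof.
move=> pF xy.
pose I : {pred {mpoly int[n]}} := [pred f | zmeval x f == 0].
have IE f : (f \in I) = (zmeval x f == 0) by [].
have [K [psi [psi_surj psi0]]] : exists (K : finFieldType) (psi : {rmorphism {mpoly int[n]} -> K}),
    (forall k, exists f, psi f = k) /\ forall f, (psi f == 0) = (f \in I).
  apply: (@quotient_finField _ F I (zmeval x)).
  - split; rewrite ?IE ?rmorph0 ?rmorph1 ?oner_eq0// => a u v.
    by rewrite !IE rmorphD rmorphM /= => /eqP-> /eqP->; rewrite mulr0 addr0.
  - by move=> u v; rewrite !IE rmorphM mulf_eq0.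
  - by move=> a b e; rewrite IE rmorphB /= e subrr.
have [g gP] := primitive_element K.
have [c cE] := psi_surj g.
have xS j : exists S : {poly int}, 'X_j - zhorner c S \in I.
  suff [S SE] : exists S, psi 'X_j = zhorner g S.
    by exists S; rewrite -psi0 rmorphB /= rmorph_zhorner cE SE subrr.
  have [->|/gP[e ->]] := eqVneq (psi 'X_j) 0; first by exists 0; rewrite rmorph0.
  by exists 'X^e; rewrite /zhorner map_polyXn !hornerE.
have [S SE] := choice xS.
have xE j : x j = zhorner (zmeval x c) (S j).
  have := SE j; rewrite IE rmorphB /= zmevalX subr_eq0 => /eqP ->.
  by rewrite rmorph_zhorner.
have yE j : y j = zhorner (zmeval y c) (S j).
  have := SE j; rewrite IE => /eqP/xy /eqP; rewrite rmorphB /= zmevalX subr_eq0.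
  by move=> /eqP ->; rewrite rmorph_zhorner.
have [i iE] : exists i, zmeval y c = iter i (Frobenius p) (zmeval x c).
  apply: conjugate_orbit => // T; rewrite -!(rmorph_zhorner (zmeval _)).
  exact: xy.
exists i => j; rewrite yE xE iE.
elim: i {iE} => //= i <-.
by rewrite /Frobenius -!(pFrobenius_autE pF) rmorph_zhorner.
Qed.

(** * Points of Proj with finite residue field *)

Lemma zmeval_scale n (L : comNzRingType) (c : L) (x : 'I_n -> L) d f :
  f \is d.-homog -> zmeval (fun i => c * x i) f = c ^+ d * zmeval x f.
Proof.
move=> /dhomogP fd; rewrite /zmeval /mmap mulr_sumr big_seq [RHS]big_seq.
apply: eq_bigr => m /fd /= <-; rewrite mulrCA; congr (_ * _).
rewrite /mmap1 mdegE -prodrXr -big_split /=.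
by apply: eq_bigr => i _; rewrite exprMn.
Qed.

Lemma partition_homog n (f : {mpoly int[n]}) :
  f = \sum_(d < msize f) pihomog mdeg d f.
Proof. exact: pihomog_partitionE. Qed.

(* The point of Proj with homogeneous coordinates [x]. *)
Definition proj_pt n (L : comNzRingType) (x : 'I_n -> L) : set {mpoly int[n]} :=
  [set f | forall d, zmeval x (pihomog mdeg d f) = 0].

Lemma proj_pt_homog n (L : comNzRingType) (x : 'I_n -> L) d f :
  f \is d.-homog -> proj_pt x f <-> zmeval x f = 0.
Proof.
move=> fd; split=> [/(_ d)|f0 e]; first by rewrite pihomog_dE.
have [<-|de] := eqVneq d e; first by rewrite pihomog_dE.
by rewrite (pihomog_ne0 de)// rmorph0.
Qed.

(* Evaluating at the generic multiple of [x] separates the homogeneous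
   components, which makes the point the kernel of a ring morphism. *)
Lemma proj_pt_kernel n (L : comNzRingType) (x : 'I_n -> L) f :
  proj_pt x f <-> zmeval (fun i => 'X * (x i)%:P) f = 0.
Proof.
have -> : zmeval (fun i => 'X * (x i)%:P) f =
    \sum_(d < msize f) (zmeval x (pihomog mdeg d f))%:P * 'X^d.
  rewrite {1}(partition_homog f) rmorph_sum /=; apply: eq_bigr => d _.
  rewrite (zmeval_scale _ _ (pihomogP _ _ _)) mulrC; congr (_ * _).
  by rewrite (rmorph_zmeval polyC).
split=> [f0|/polyP h d].
  by rewrite big1// => d _; rewrite f0 mul0r.
have [dn|nd] := ltnP d (msize f).
  have := h d; rewrite coef_sum coef0 (bigD1 (Ordinal dn)) //= coefCM coefXn eqxx.
  rewrite mulr1 big1 ?addr0// => i; rewrite -val_eqE /= => id.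
  by rewrite coefCM coefXn eq_sym (negPf id) mulr0.
have -> : pihomog mdeg d f = 0; last exact: rmorph0.
rewrite [X in pihomog _ _ X]partition_homog raddf_sum; apply: big1 => i _.
apply: (pihomog_ne0 (d := i)); last exact: pihomogP.
by rewrite ltn_eqF// (leq_trans _ nd).
Qed.

Lemma proj_ptP n (L : idomainType) (x : 'I_n -> L) i : x i != 0 ->
  is_proj_point (proj_pt x).
Proof.
move=> xi; set X : 'I_n -> {poly L} := fun i => 'X * (x i)%:P.
have memE f : (f \in mem (proj_pt x)) = (zmeval X f == 0).
  by apply/asboolP/eqP => /proj_pt_kernel.
split.
- split; rewrite ?memE ?rmorph0 ?rmorph1 ?oner_eq0// => a u v.
  by rewrite !memE rmorphD rmorphM /= => /eqP-> /eqP->; rewrite mulr0 addr0.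
- by move=> u v; rewrite !memE rmorphM mulf_eq0.
- move=> f d fx; apply/(proj_pt_homog _ (pihomogP _ _ _)).
  exact: fx.
- exists i => /(proj_pt_homog _ (_ : _ \is 1.-homog)) h.
  move: xi; rewrite -(zmevalX x i) h ?eqxx//.
  by rewrite dhomogX /= mdeg1.
Qed.

Lemma proj_ptX n (L : comNzRingType) (x : 'I_n -> L) i : proj_pt x 'X_i <-> x i = 0.
Proof.
by have := @proj_pt_homog _ _ x 1%N 'X_i; rewrite zmevalX dhomogX /= mdeg1 => /(_ erefl).
Qed.

(** If a form [g] of degree [d] in [P] did not vanish at [x], then for [N = #|F| - 1] both [g ^ N]
    and ['X_j ^ (d * N)] would take the value 1 at [x]. Their difference is a form vanishing at [x],
    hence in [P], which would force ['X_j] into [P]. *)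
Lemma proj_pt_maximal n (F : finFieldType) (x : 'I_n -> F) P :
  is_proj_point P -> proj_pt x `<=` P -> P = proj_pt x.
Proof.
move=> [[P0 P1 PD] Pp Ph [j Pj]] xP; apply/seteqP; split => // f Pf d.
have memP g : (g \in mem P) <-> P g by split=> [/asboolP|?]//; exact/asboolP.
have xj : x j != 0 by apply: contra_notN Pj => /eqP /proj_ptX /xP.
apply/eqP/negPn/negP => fx0; apply: Pj.
set g := pihomog mdeg d f in fx0; have gd : g \is d.-homog by exact: pihomogP.
pose N := #|F|.-1.
have N0 : (0 < N)%N by rewrite /N -subn1 subn_gt0 card_finNzRing_gt1.
have x1 (y : F) : y != 0 -> y ^+ N = 1.
  move=> y0; apply: (mulfI y0); rewrite mulr1 -exprS prednK ?expf_card//.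
  by rewrite (ltn_trans _ (card_finNzRing_gt1 F)).
have expP h k : P (h ^+ k) -> P h.
  elim: k => [/memP|k IH /memP]; first by rewrite expr0 (negPf P1).
  by rewrite exprS => /Pp/orP[] /memP.
have Pg : P g by exact: Ph.
apply: (expP _ (d * N)%N); apply/memP.
have -> : 'X_j ^+ (d * N) =
    (-1) * (g ^+ N - 'X_j ^+ (d * N)) + (g ^+ N.-1 * g + 0) :> {mpoly int[n]}.
  by rewrite addr0 -exprSr prednK// mulN1r opprB subrK.
apply: (PD); apply/memP; last by apply/memP/PD => //; exact/memP.
have hXj : 'X_j ^+ (d * N) \is [in int[n], (d * N).-homog].
  by rewrite -[X in X.-homog]mul1n; apply: dhomogMn; rewrite dhomogX /= mdeg1.
apply/xP/(@proj_pt_homog _ _ _ (d * N)%N).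
  by rewrite rpredB//; exact: dhomogMn.
by rewrite rmorphB !rmorphXn /= zmevalX mulnC exprM !x1 ?expr1n ?subrr.
Qed.

Lemma card_eq_images (T : choiceType) (U V : Type) (A : set T) (f : T -> U) (g : T -> V) :
  (forall a b, A a -> A b -> f a = f b <-> g a = g b) -> (f @` A #= g @` A)%card.
Proof.
suff le (U' V' : Type) (f' : T -> U') (g' : T -> V') :
    (forall a b, A a -> A b -> f' a = f' b -> g' a = g' b) ->
    (g' @` A #<= f' @` A)%card.
  by move=> fg; apply/card_eqPle; split; apply: le => a b Aa Ab /fg; exact.
move=> fg; have [->|/set0P[a0 Aa0]] := eqVneq A set0; first by rewrite !image_set0.
pose h y := g' (xget a0 [set a | A a /\ f' a = y]).
suff -> : g' @` A = h @` (f' @` A) by exact: card_image_le.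
have hE a : A a -> h (f' a) = g' a.
  move=> Aa; rewrite /h; case: xgetP => [b _ [Ab fb]|/(_ a)]; last by case.
  exact: fg.
apply/seteqP; split=> [_ [a Aa <-]|_ [_ [a Aa <-] <-]].
  by exists (f' a); [exists a|exact: hE].
by exists a => //; rewrite hE.
Qed.

Lemma card_eq_setT (T : finType) : ([set: T] #= `I_#|T|)%card.
Proof.
apply/card_set_bijP; exists (fun x => val (enum_rank x)); split.
- by move=> x _ /=.
- by move=> x y _ _ /val_inj/enum_rank_inj.
- by move=> k kT; exists (enum_val (Ordinal kT)) => //; rewrite enum_valK.
Qed.

(** For a nonzero [f], [msize f] is one more than the degree, so this is the usual homogenization
    with one extra factor ['X_i]. *)
Definition homogenize n (i : 'I_n) (f : {mpoly int[n]}) : {mpoly int[n]} :=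
  \sum_(d < msize f) pihomog mdeg d f * 'X_i ^+ (msize f - d).

Lemma dhomogXn n (i : 'I_n) k : ('X_i ^+ k : {mpoly int[n]}) \is k.-homog.
Proof. by rewrite -[X in X.-homog]mul1n; apply: dhomogMn; rewrite dhomogX /= mdeg1. Qed.

Lemma homogenizeP n (i : 'I_n) f : homogenize i f \is (msize f).-homog.
Proof.
apply: rpred_sum => d _.
have := dhomogM (pihomogP mdeg d f) (dhomogXn i (msize f - d)).
by rewrite subnKC// ltnW.
Qed.

Lemma zmeval_homogenize n (L : fieldType) (x : 'I_n -> L) i f : x i != 0 ->
  zmeval x (homogenize i f) = x i ^+ msize f * zmeval (fun j => x j / x i) f.
Proof.
move=> xi; have -> : zmeval (fun j => x j / x i) f =
    \sum_(d < msize f) zmeval (fun j => x j / x i) (pihomog mdeg d f).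
  by rewrite [X in zmeval _ X]partition_homog rmorph_sum.
rewrite rmorph_sum mulr_sumr /=.
apply: eq_bigr => d _; rewrite rmorphM rmorphXn /= zmevalX.
rewrite (@eq_zmeval _ _ x (fun j => x i * (x j / x i))); last first.
  by move=> j; rewrite mulrCA divff ?mulr1.
rewrite (zmeval_scale _ _ (pihomogP _ _ _)) mulrAC -exprD subnKC//.
exact: ltnW.
Qed.

Lemma invr_expf_card (F : finFieldType) (x : F) : x != 0 -> x^-1 = x ^+ #|F|.-2.
Proof.
move=> x0; have := expf_card x; case: #|F| (card_finNzRing_gt1 F) => [|[|k]]// _ /=.
rewrite !exprS => xk; apply: (mulfI x0); rewrite divff//.
by apply: (mulfI x0); rewrite xk mulr1.
Qed.

(** The class of a fraction is determined by its value at [x]. As [x i = 1], homogenizing with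
    powers of ['X_i] keeps values, so every value of a polynomial is the value of a fraction. *)
Lemma residue_field_pt n (F : finFieldType) (x : 'I_n -> F) i : x i = 1 ->
  (residue_field (proj_pt x) #= range (zmeval x))%card.
Proof.
move=> xi; pose e u := zmeval x u.1 / zmeval x u.2.
have proj_pt0 u d : u \is d.-homog -> proj_pt x u <-> zmeval x u = 0 by exact: proj_pt_homog.
have -> : range (zmeval x) = e @` hfrac (proj_pt x).
  apply/seteqP; split => [_ [f _ <-]|_ [u [Pu [d [_ u2]]] <-]].
    exists (homogenize i f, 'X_i ^+ msize f).
      split; last by exists (msize f); split; [exact: homogenizeP|exact: dhomogXn].
      by move=> /(proj_pt0 _ _ (dhomogXn _ _))/eqP; rewrite rmorphXn /= zmevalX xi expr1n oner_eq0.
    rewrite /e /= zmeval_homogenize xi ?oner_neq0// rmorphXn /= zmevalX xi expr1n mul1r divr1.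
    by apply: eq_zmeval => j; rewrite divr1.
  (* Inversion in [F] is a power map, so the value of a fraction is also the value of a
     polynomial. *)
  exists (u.1 * u.2 ^+ (#|F|.-2)) => //; rewrite /e rmorphM rmorphXn /=; congr (_ * _).
  by rewrite invr_expf_card//; apply/eqP => /(proj_pt0 _ _ u2).
apply: card_eq_images => u v [Pu [d [u1 u2]]] [Pv [d' [v1 v2]]].
have u0 : zmeval x u.2 != 0 by apply/eqP => /(proj_pt0 _ _ u2).
have v0 : zmeval x v.2 != 0 by apply/eqP => /(proj_pt0 _ _ v2).
have clsE w w' : hfrac (proj_pt x) w -> hfrac (proj_pt x) w' -> hfrac_class (proj_pt x) w w' <-> e w' = e w.
  move=> [Pw [k [w1 w2]]] [Pw' [k' [w1' w2']]].
  have w0 : zmeval x w.2 != 0 by apply/eqP => /(proj_pt0 _ _ w2).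
  have w0' : zmeval x w'.2 != 0 by apply/eqP => /(proj_pt0 _ _ w2').
  have hh : w'.1 * w.2 - w.1 * w'.2 \is [in int[n], (k + k').-homog].
    by rewrite rpredB//; [rewrite addnC|]; exact: dhomogM.
  transitivity (proj_pt x (w'.1 * w.2 - w.1 * w'.2)).
    by split => [[]//|?]; split => //; split => //; exists k'.
  rewrite (proj_pt0 _ _ hh) rmorphB !rmorphM /=; split.
    by move=> /eqP; rewrite subr_eq0 => /eqP h; apply/eqP; rewrite /e eqr_div// h.
  by move=> /eqP; rewrite /e eqr_div// => /eqP ->; rewrite subrr.
have hu : hfrac (proj_pt x) u by split=> //; exists d.
have hv : hfrac (proj_pt x) v by split=> //; exists d'.
split => [uv|euv].
  by apply/(clsE _ _ hv hu); rewrite -uv; apply/clsE.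
apply/seteqP; split=> w wP; have hw : hfrac (proj_pt x) w by case: wP.
  by move: wP => /(clsE _ _ hu hw) ew; apply/clsE; rewrite // ew euv.
by move: wP => /(clsE _ _ hv hw) ew; apply/clsE; rewrite // ew euv.
Qed.

Lemma zmeval_generic n (f : {mpoly int[n]}) : zmeval (fun j => 'X_j) f = f.
Proof.
rewrite [RHS]mpolyE /zmeval /mmap; apply: eq_bigr => m _.
by rewrite mmap1_id mulrzl -[in RHS](intz f@_m) scaler_int.
Qed.

Section Dehomogenize.
Variables (n : nat) (P : set {mpoly int[n]}) (i : 'I_n).
Hypotheses (projP : is_proj_point P) (Xi : ~ P 'X_i).
Local Notation Q := {mpoly int[n]}.
Let iota : {rmorphism Q -> {fraction Q}} := @tofrac Q.
Let X := iota 'X_i.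
(** Dehomogenization by the substitution of ['X_j / 'X_i] for ['X_j]. Working in the fraction field
    characterises a homogenization [F] of [f] in degree [N] by the equation
    [F = 'X_i ^ N * eps f]. *)
Let eps : {rmorphism Q -> {fraction Q}} := zmeval (fun j => iota 'X_j / X).

Let X0 : X != 0.
Proof. by rewrite tofrac_eq0; apply: contra_notN Xi => /eqP ->; case: projP => -[/asboolP]. Qed.

Let tofrac_homog d f : f \is d.-homog -> iota f = X ^+ d * eps f.
Proof.
move=> fd; rewrite -(zmeval_scale _ _ fd) -[in LHS](zmeval_generic f) rmorph_zmeval.
by apply: eq_zmeval => j; rewrite mulrCA divff ?mulr1.
Qed.

Let tofrac_homogenize f : iota (homogenize i f) = X ^+ msize f * eps f.
Proof.
rewrite -[in LHS](zmeval_generic (homogenize i f)) rmorph_zmeval.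
by rewrite zmeval_homogenize.
Qed.

(* As [f] determines its homogenizations [F] up to powers of ['X_i], all of them
   are in [P] as soon as one is. *)
Let dehom : {pred Q} := [pred f | `[< exists N F, [/\ F \is N.-homog, P F &
  iota F = X ^+ N * eps f] >]].

Let iotaI : injective iota.
Proof. by move=> x y /eqP; rewrite tofrac_eq => /eqP. Qed.

Let PM f g : P (f * g) -> P f \/ P g.
Proof. by case: projP => _ Pp _ _ /asboolP/Pp/orP[] /asboolP; [left|right]. Qed.

Let PMr f g : P g -> P (f * g).
Proof.
case: projP => -[P0 _ PD] _ _ _ Pg; rewrite -[_ * _]addr0.
by apply/asboolP/PD => //; apply/asboolP.
Qed.

Let PD f g : P f -> P g -> P (f + g).
Proof.
case: projP => -[_ _ PD] _ _ _ Pf Pg; rewrite -[f]mul1r.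
by apply/asboolP/PD; apply/asboolP.
Qed.

Let PX k : ~ P ('X_i ^+ k).
Proof.
elim: k => [|k IH]; first by case: projP => -[_ /negP P1 _] _ _ _ /asboolP.
by rewrite exprS => /PM[].
Qed.

Let dehomE f N F : iota F = X ^+ N * eps f -> f \in dehom -> P F.
Proof.
move=> FE /asboolP[M [G [_ PG GE]]].
have : P ('X_i ^+ M * F).
  have -> : 'X_i ^+ M * F = 'X_i ^+ N * G; last exact: PMr.
  by apply: iotaI; rewrite !rmorphM !rmorphXn /= FE GE mulrCA.
by move=> /PM[/PX|].
Qed.

Let dehomP f N F : F \is N.-homog -> iota F = X ^+ N * eps f -> P F -> f \in dehom.
Proof. by move=> FN FE PF; apply/asboolP; exists N, F. Qed.

Let dehom_ideal : idealr_closed dehom.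
Proof.
split.
- apply: (@dehomP _ 0 0); rewrite ?rpred0 ?rmorph0 ?mulr0//.
  by case: projP => -[/asboolP].
- apply/negP => /(@dehomE _ 0 1); rewrite !rmorph1 mulr1 => /(_ erefl).
  exact: (@PX 0).
- move=> a u v /asboolP[N [F [FN PF FE]]] /asboolP[M [G [GM PG GE]]].
  pose H := 'X_i ^+ M * (homogenize i a * F) + 'X_i ^+ (msize a + N) * G.
  apply: (@dehomP _ (M + (msize a + N))%N H).
  + rewrite rpredD//; last by rewrite (addnC M); apply: dhomogM => //; exact: dhomogXn.
    by apply: dhomogM; [exact: dhomogXn|apply: dhomogM => //; exact: homogenizeP].
  + rewrite /H !(rmorphD, rmorphM, rmorphXn) /= FE GE tofrac_homogenize -/X.
    rewrite !exprD mulrDr; congr (_ + _); last by rewrite mulrCA mulrA.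
    rewrite -!mulrA; congr (_ * (_ * _)).
    by rewrite mulrCA.
  + by apply: PD; [do 2!apply: PMr|apply: PMr].
Qed.

Let dehom_prime : prime_idealr_closed dehom.
Proof.
move=> f g /(@dehomE _ (msize f + msize g) (homogenize i f * homogenize i g)).
rewrite !rmorphM /= !tofrac_homogenize exprD mulrACA => /(_ erefl) /PM.
by case=> h; apply/orP; [left|right]; exact: (dehomP (homogenizeP i _) (tofrac_homogenize _) h).
Qed.

Let dehom_homog d f : f \is d.-homog -> (f \in dehom) <-> P f.
Proof.
move=> fd; split; first exact: dehomE (tofrac_homog fd).
exact: (dehomP fd (tofrac_homog fd)).
Qed.

Let P_homog f : P f <-> forall d, P (pihomog mdeg d f).
Proof.
case: projP => -[P0 _ _] _ Ph _; split=> [Pf d|h]; first exact: Ph.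
rewrite [f]partition_homog; elim/big_ind: _ => [||d _]; [exact/asboolP|exact: PD|exact: h].
Qed.

(** Polynomials whose fractions over powers of ['X_i] have the same class differ by an element of
    the prime ideal [dehom]. The quotient by [dehom] is thus finite, hence a field, and the images
    of the variables in it are the coordinates. *)
Lemma proj_point_pt q : (residue_field P #= `I_q)%card ->
  exists (K : finFieldType) (x : 'I_n -> K),
    [/\ x i = 1, P = proj_pt x, (forall k, exists f, zmeval x f = k) & #|K| = q].
Proof.
move=> /card_set_bijP[b bB]; have [bP bI _] := bB.
pose u (f : Q) : Q * Q := (homogenize i f, 'X_i ^+ msize f).
have hu f : hfrac P (u f).
  by split; [exact: PX|exists (msize f); split; [exact: homogenizeP|exact: dhomogXn]].
pose cls f := hfrac_class P (u f).
have clsP f : residue_field P (cls f) by exists (u f).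
have clsI f g : cls f = cls g -> f - g \in dehom.
  move=> fg; have : cls g (u f).
    rewrite -fg; split=> //=; rewrite subrr.
    by case: projP => -[/asboolP].
  move=> [_ /=]; apply: (@dehomP _ (msize f + msize g)).
    rewrite rpredB//; last rewrite addnC.
      by apply: dhomogM; [exact: homogenizeP|exact: dhomogXn].
    by apply: dhomogM; [exact: homogenizeP|exact: dhomogXn].
  rewrite rmorphB !rmorphM !rmorphXn /= !tofrac_homogenize -/X rmorphB /= exprD.
  by rewrite mulrBr mulrAC; congr (_ - _); rewrite mulrC mulrA.
have bq f : (b (cls f) < q.+1)%N by apply: ltnW; exact: (bP _ (clsP f)).
have [|K [psi [psi_surj psi0]]] :=
    @quotient_finField Q 'I_q.+1 dehom (fun f => Ordinal (bq f)) dehom_ideal dehom_prime.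
  by move=> f g /(congr1 val) /= /bI e; apply/clsI/e; exact/mem_set/clsP.
have psiE f : psi f = zmeval (fun j => psi 'X_j) f.
  by rewrite -[in LHS](zmeval_generic f) rmorph_zmeval.
have x1 : psi 'X_i = 1.
  apply/eqP; rewrite -subr_eq0 -(rmorph1 psi) -rmorphB psi0.
  apply: (@dehomP _ 0 0); rewrite ?rpred0//; last by case: projP => -[/asboolP].
  by rewrite rmorph0 rmorphB rmorph1 /= zmevalX divff// subrr mulr0.
have PE : P = proj_pt (fun j => psi 'X_j).
  apply/seteqP; split=> [f /P_homog h d|f h].
    apply/eqP; rewrite -psiE psi0; apply/(dehom_homog (pihomogP _ _ _)).
    exact: h.
  apply/P_homog => d; apply/(dehom_homog (pihomogP _ _ _)).
  by rewrite -psi0 psiE h.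
have surj k : exists f, zmeval (fun j => psi 'X_j) f = k.
  by have [f <-] := psi_surj k; exists f; rewrite psiE.
exists K, (fun j => psi 'X_j); split=> //.
(* So far [K] is only known to be finite; its cardinality comes from computing the residue field of
   the point again from its coordinates. *)
have : (`I_#|K| #= `I_q)%card.
  have rK : range (zmeval (fun j => psi 'X_j)) = [set: K].
    by apply/seteqP; split=> // k _; have [f <-] := surj k; exists f.
  have := residue_field_pt (x := fun j => psi 'X_j) x1.
  rewrite -PE rK card_eq_sym => Kr.
  apply: (card_eq_trans (card_esym (card_eq_setT K))); apply: (card_eq_trans Kr).
  by apply/card_set_bijP; exists b.
by move=> /card_eq_II.
Qed.
End Dehomogenize.

(** * Counting closed points *)

Lemma iter_order_dvdn (T : finType) (f : T -> T) k x : injective f ->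
  iter k f x = x -> (order f x %| k)%N.
Proof.
move=> injf; rewrite {1}(divn_eq k (order f x)) addnC iterD.
have -> : iter (k %/ order f x * order f x) f x = x.
  by elim: (k %/ _)%N => // j IH; rewrite mulSn iterD IH iter_order.
have ro : (k %% order f x < order f x)%N by rewrite ltn_mod order_gt0.
move=> e; have := findex_iter ro; rewrite e findex0 => r0.
by rewrite /dvdn -r0.
Qed.

Lemma card_eq_pred (T : finType) (D : {pred T}) :
  ([set x | x \in D] #= `I_#|D|)%card.
Proof.
apply/card_set_bijP; exists (fun x => index x (enum D)); split.
- by move=> x /= xD; rewrite cardE index_mem mem_enum.
- move=> x y; rewrite !inE /= => xD yD e.
  by rewrite -(nth_index x (s := enum D) (x := x)) ?mem_enum// e nth_index ?mem_enum.
- move=> k /=; rewrite cardE => kD; have [x0 _] : exists x, x \in D.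
    by case: (enum D) (mem_enum D) kD => // x s /(_ x); rewrite mem_head => ? _; exists x.
  exists (nth x0 (enum D) k); last by rewrite index_uniq ?enum_uniq.
  by rewrite /= -mem_enum mem_nth.
Qed.

Section Count.
Variables (n : nat) (SS : {set {set 'I_n}}).

Definition vsupport (P : set {mpoly int[n]}) : {set 'I_n} :=
  finset (fun i => ~~ `[< P 'X_i >]).

Definition supported : set (set {mpoly int[n]}) :=
  [set P | is_proj_point P /\ vsupport P \in SS].

Definition csupport (F : nzRingType) (x : 'I_n -> F) : {set 'I_n} := finset (fun i => x i != 0).

(* One representative in each class of proportional coordinate vectors. *)
Definition normalised (F : finFieldType) : {pred {ffun 'I_n -> F}} := fun x =>
  (csupport x \in SS) && (if [pick i in csupport x] is Some i then x i == 1 else false).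

Arguments normalised F x : clear implicits.

Lemma vsupport_pt (F : finFieldType) (x : 'I_n -> F) : vsupport (proj_pt x) = csupport x.
Proof. by apply/setP => i; rewrite !inE; congr (~~ _); apply/asboolP/eqP => /proj_ptX. Qed.

(** Over a support [S], the coordinate selected by [pick] is 1 and the others are arbitrary nonzero
    elements. On the empty support [pick] fails, so that it contributes nothing. *)
Lemma card_normalised (F : finFieldType) :
  #|normalised F| = (\sum_(S in SS | S != finset.set0) (#|F|.-1) ^ (#|S|.-1))%N.
Proof.
rewrite -sum1_card.
rewrite (partition_big (fun x : {ffun 'I_n -> F} => csupport x)
  (fun S => (S \in SS) && (S != finset.set0))) /=; last first.
  move=> x /andP[-> ]; case: pickP => // i xi _; apply/set0Pn; by exists i.
apply: eq_bigr => S /andP[SSS S0]; rewrite sum1_card.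
have [i0 i0S pickS] : exists2 i0, i0 \in S & [pick i in S] = Some i0.
  case: pickP => [j jS|S00]; first by exists j.
  by case/set0Pn: S0 => i; rewrite S00.
pose fam j : pred F := if j == i0 then pred1 1 else predC1 0.
have e : [pred x | normalised F x & csupport x == S] =i pfamily 0 S fam.
  move=> x; apply/andP/pfamilyP => [[/andP[_ hx] /eqP xS]|[xsup xfam]].
    split; first by apply/fintype.subsetP => j; rewrite inE => xj; rewrite -xS inE.
    move=> j jS; rewrite /fam; case: eqP => [->|_]; last by move: jS; rewrite -xS inE.
    by move: hx; rewrite xS pickS.
  have xS : csupport x = S.
    apply/setP => j; rewrite inE; apply/idP/idP => [xj|/xfam].
      by apply: (fintype.subsetP xsup); rewrite inE.
    by rewrite /fam; case: eqP => // _ /eqP ->; rewrite oner_neq0.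
  rewrite xS eqxx; split=> //; rewrite /normalised xS SSS pickS /=.
  by have := xfam _ i0S; rewrite /fam eqxx.
rewrite (eq_card e) card_pfamily foldrE big_image.
rewrite (bigD1 i0) //= /fam eqxx card1 mul1n.
under eq_bigr => j /andP[_ /negPf ji] do rewrite ji cardC1.
rewrite prod_nat_const; congr (_ ^ _)%N.
by rewrite (cardD1 i0 (mem S)) i0S /=; apply: eq_card => j; rewrite !inE andbC.
Qed.
End Count.
Arguments normalised {n} SS F x.

Lemma zmeval_Frobenius n (F : finFieldType) p (x : 'I_n -> F) k f : p \in [pchar F] ->
  zmeval (fun j => iter k (Frobenius p) (x j)) f = iter k (Frobenius p) (zmeval x f).
Proof.
move=> pF; elim: k => [|k IH] /=; first exact: eq_zmeval.
by rewrite -IH /Frobenius -(pFrobenius_autE pF) rmorph_zmeval.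
Qed.

Lemma iter_Frobenius (F : finFieldType) p k (x : F) : iter k (Frobenius p) x = x ^+ (p ^ k).
Proof. by elim: k => //= k ->; rewrite /Frobenius -exprM expnSr. Qed.

(** Homogenizing with respect to a coordinate equal to 1 does not affect vanishing, so the
    homogeneous ideal controls inhomogeneous polynomials too. *)
Lemma eq_proj_ptP n (L M : fieldType) (x : 'I_n -> L) (y : 'I_n -> M) i :
  x i = 1 -> y i = 1 -> proj_pt x = proj_pt y -> forall f, zmeval x f = 0 <-> zmeval y f = 0.
Proof.
move=> xi yi xy f.
have h (N : fieldType) (z : 'I_n -> N) : z i = 1 -> zmeval z f = 0 <-> proj_pt z (homogenize i f).
  move=> zi; rewrite (proj_pt_homog _ (homogenizeP i f)) zmeval_homogenize zi ?oner_neq0//.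
  by rewrite expr1n mul1r (@eq_zmeval _ _ _ z)// => j; rewrite divr1.
by rewrite (h _ x)// (h _ y)// xy.
Qed.

Lemma card_le_Frobenius_fixed (K : finFieldType) N : (1 < N)%N ->
  (forall y : K, y ^+ N = y) -> (#|K| <= N)%N.
Proof.
move=> N1 h; pose q : {poly K} := 'X^N - 'X.
have sz : size q = N.+1.
  by rewrite /q size_polyDl size_polyXn// size_polyN size_polyX ltnS.
rewrite -ltnS -sz cardE; apply: max_poly_roots; last exact: enum_uniq.
  by rewrite -size_poly_gt0 sz.
by apply/allP => y _; rewrite rootE /q !hornerE h subrr.
Qed.

(** * Closed points as Frobenius orbits of coordinate vectors *)

Section Orbits.
Variables (n : nat) (SS : {set {set 'I_n}}) (F : finFieldType) (p m : nat).
Hypotheses (pF : p \in [pchar F]) (cF : #|F| = (p ^ m)%N) (m0 : (0 < m)%N).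

Definition ffrob (x : {ffun 'I_n -> F}) : {ffun 'I_n -> F} := [ffun i => Frobenius p (x i)].

Let p1 : (1 < p)%N.
Proof. by rewrite prime_gt1// (pcharf_prime pF). Qed.

Lemma iter_ffrob k x j : iter k ffrob x j = iter k (Frobenius p) (x j).
Proof. by elim: k => //= k <-; rewrite ffunE. Qed.

Lemma ffrob_inj : injective ffrob.
Proof.
move=> x y /ffunP e; apply/ffunP => j; have := e j; rewrite !ffunE.
exact: Frobenius_inj.
Qed.

Lemma iter_ffrobP k x : iter k ffrob x = x <-> forall j, x j ^+ (p ^ k) = x j.
Proof.
split=> [e j|h]; first by rewrite -iter_Frobenius -iter_ffrob e.
by apply/ffunP => j; rewrite iter_ffrob iter_Frobenius.
Qed.

Lemma normalised_ffrob x : (ffrob x \in normalised SS F) = (x \in normalised SS F).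
Proof.
have e : csupport (ffrob x) = csupport x.
  apply/setP => j; rewrite !inE ffunE /Frobenius expf_eq0 (prime_gt0)//.
  exact: pcharf_prime pF.
rewrite -!topredE /= /normalised e; congr (_ && _); case: pickP => // i _.
rewrite ffunE; apply/eqP/eqP => [|->]; last by rewrite /Frobenius expr1n.
by move=> xi; apply: (Frobenius_inj pF); rewrite expr1n.
Qed.

Lemma pt_iter_ffrob k x : proj_pt (iter k ffrob x) = proj_pt x.
Proof.
suff h f : zmeval (iter k ffrob x) f = 0 <-> zmeval x f = 0.
  by apply/seteqP; split=> f fx d; apply/h; exact: fx.
rewrite (@eq_zmeval _ _ _ (fun j => iter k (Frobenius p) (x j))); last exact: iter_ffrob.
rewrite (zmeval_Frobenius _ _ _ pF) iter_Frobenius; split => [/eqP|->].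
  by rewrite expf_eq0 expn_gt0 (ltnW p1) => /eqP.
by rewrite expr0n gtn_eqF// expn_gt0 (ltnW p1).
Qed.

Lemma normalisedP x : x \in normalised SS F ->
  exists i, [/\ x i = 1, csupport x \in SS & [pick i in csupport x] = Some i].
Proof.
move=> /andP[xS]; case E: [pick i in _] => [i|//] /eqP xi.
by exists i.
Qed.

Lemma order_dvd x : (order ffrob x %| m)%N.
Proof.
apply: iter_order_dvdn; first exact: ffrob_inj.
by apply/iter_ffrobP => j; rewrite -cF expf_card.
Qed.

(** The coordinates generate the residue field, so an iterate of Frobenius fixes [x] exactly when it
    is the identity on that field; the least such iterate is the degree over the prime field. *)
Lemma residue_field_order x : x \in normalised SS F ->
  (residue_field (proj_pt x) #= `I_(p ^ order ffrob x))%card.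
Proof.
move=> /normalisedP[i [xi xS _]].
have := residue_field_pt xi.
have : finite_set (range (zmeval x)) by apply: (sub_finite_set (B := [set: F])).
move=> [q rq] /card_eq_trans /(_ rq) xq.
have [||K [y [yi xy surj cK]]] := @proj_point_pt n (proj_pt x) i _ _ q xq.
- by apply: (proj_ptP (i := i)); rewrite xi oner_neq0.
- by move=> /proj_ptX /eqP; rewrite xi oner_eq0.
have xyE f : zmeval x f = 0 <-> zmeval y f = 0 by exact: (eq_proj_ptP xi yi xy).
have pK : p \in [pchar K].
  rewrite inE (pcharf_prime pF) /= -(rmorph_nat (zmeval y)); apply/eqP/xyE.
  by rewrite rmorph_nat (pcharf0 pF).
have [e cKe] : exists e, #|K| = (p ^ e)%N by exists (logn p #|K|); exact: card_pprimeChar pK.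
have fixE k : (forall j, x j ^+ (p ^ k) = x j) <-> (forall z : K, z ^+ (p ^ k) = z).
  have E j : x j ^+ (p ^ k) = x j <-> y j ^+ (p ^ k) = y j.
    have := xyE ('X_j ^+ (p ^ k) - 'X_j); rewrite !rmorphB !rmorphXn /= !zmevalX => h.
    by split=> /eqP; rewrite -subr_eq0 => /eqP/h/eqP; rewrite subr_eq0 => /eqP.
  split=> h => [z|j]; last by apply/E.
  have [f <-] := surj z; rewrite -iter_Frobenius -zmeval_Frobenius//; apply: eq_zmeval => j.
  by rewrite iter_Frobenius; apply/E.
have e0 : (0 < e)%N.
  by rewrite lt0n; apply: contraTneq (card_finNzRing_gt1 K) => ee; rewrite cKe ee.
suff -> : order ffrob x = e by rewrite -cKe cK.
apply/eqP; rewrite eqn_leq; apply/andP; split.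
  apply: dvdn_leq => //; apply: iter_order_dvdn; first exact: ffrob_inj.
  by apply/iter_ffrobP/fixE => z; rewrite -cKe expf_card.
rewrite -(leq_exp2l _ _ p1) -cKe; apply: card_le_Frobenius_fixed.
  by rewrite -(expn0 p) ltn_exp2l// order_gt0.
by apply/fixE/iter_ffrobP; exact: iter_order ffrob_inj _.
Qed.

(** The point has coordinates in its own residue field, which are transferred to [F] because [d]
    divides [m]. *)
Lemma closed_point_lift P d : (d %| m)%N -> supported SS P ->
  (residue_field P #= `I_(p ^ d))%card ->
  exists x, [/\ x \in normalised SS F, order ffrob x = d & P = proj_pt x].
Proof.
move=> dm [projP PS] Pd.
have [j Pj] : exists j, ~ P 'X_j by case: projP.
have jP : j \in vsupport P by rewrite inE; apply/negP => /asboolP.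
(* The coordinate set to 1 must be the one that [pick] selects in [normalised]. *)
have [i iP pickP] : exists2 i, i \in vsupport P & [pick i in vsupport P] = Some i.
  case: pickP => [k kP|/(_ j)]; first by exists k.
  by rewrite jP.
have Pi : ~ P 'X_i by move: iP; rewrite inE => /negP h /asboolP.
have [K [y [yi Py _ cK]]] := proj_point_pt projP Pi Pd.
have d0 : (0 < d)%N.
  by rewrite lt0n; apply: contraTneq (card_finNzRing_gt1 K) => ee; rewrite cK ee.
have pK := card_finPcharP cK (pcharf_prime pF).
have [x xy] := zmeval_transfer y pK pF cK cF m0 dm.
have xE : proj_pt (finfun x) = P.
  rewrite Py; apply/seteqP; split=> f fx k; apply/eqP.
    by rewrite xy (@eq_zmeval _ _ _ (finfun x)) ?fx// => l; rewrite ffunE.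
  by rewrite (@eq_zmeval _ _ _ x) -?xy ?fx// => l; rewrite ffunE.
have sx : csupport (finfun x) = vsupport P by rewrite -xE vsupport_pt.
have xn : finfun x \in normalised SS F.
  (* Only vanishing survives the transfer, so [x i = 1] is read as the vanishing of ['X_i - 1]. *)
  rewrite -topredE /= /normalised sx PS pickP ffunE -subr_eq0.
  by rewrite -(zmevalX x) -(rmorph1 (zmeval x)) -rmorphB -xy rmorphB rmorph1 /= zmevalX yi subrr.
exists (finfun x); split => //.
have := residue_field_order xn; rewrite xE card_eq_sym => /card_eq_trans /(_ Pd).
by move=> /card_eq_II /eqP; rewrite eqn_exp2l// => /eqP.
Qed.

(** Equal points have equal supports, so both vectors are normalised at the same coordinate and
    annihilate the same polynomials, which makes them conjugate. *)
Lemma pt_fconnect x y : x \in normalised SS F -> y \in normalised SS F ->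
  proj_pt x = proj_pt y -> fconnect ffrob x y.
Proof.
move=> /normalisedP[i [xi _ pi]] /normalisedP[i' [yi _ pi']] xy.
move: yi; have -> : i' = i.
  by move: pi'; rewrite -vsupport_pt -xy vsupport_pt pi => -[].
move=> yi; have [k kE] := zmeval_conjugate pF (fun f => (eq_proj_ptP xi yi xy f).1).
suff -> : y = iter k ffrob x by exact: fconnect_iter.
by apply/ffunP => j; rewrite iter_ffrob.
Qed.

(** Each orbit of size [d] is represented by its canonical root. Thus [b] is a number of orbits, and
    [b * d] is the number of their elements. *)
Lemma card_closed_points d : (d %| m)%N ->
  exists2 b, (closed_points_of_norm (supported SS) (p ^ d) #= `I_b)%card &
    (b * d)%N = #|[pred x in normalised SS F | order ffrob x == d]|.
Proof.
move=> dm; set A := [pred x in _ | _].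
have sym := fconnect_sym ffrob_inj.
have Acl : fclosed ffrob A.
  apply: (intro_closed sym) => x _ /eqP <- /andP[xn /eqP xd].
  apply/andP; split; first by rewrite normalised_ffrob.
  by rewrite order_id_cycle ?xd//; exact: cycle_orbit ffrob_inj _.
exists (fcard ffrob A); last first.
  apply: fcard_order_set Acl; first exact: ffrob_inj.
  by apply/fintype.subsetP => x /andP[].
pose D := [predI froots ffrob & A].
have -> : closed_points_of_norm (supported SS) (p ^ d) =
    (fun x : {ffun 'I_n -> F} => proj_pt x) @` [set x | x \in D].
  apply/seteqP; split=> [P [PX _ Pd]|_ [x /andP[_ /andP[xn /eqP xd]] <-]].
    have [x [xn xd ->]] := closed_point_lift dm PX Pd.
    have xr := connect_root (frel ffrob) x.
    exists (froot ffrob x); last by rewrite -(iter_findex xr) pt_iter_ffrob.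
    rewrite /= inE; apply/andP; split; first exact: (roots_root sym).
    by rewrite -(closed_connect Acl xr) inE xn xd eqxx.
  split.
  - split; last by rewrite vsupport_pt; case/normalisedP: xn => i [].
    by have [i [xi _ _]] := normalisedP xn; apply: (proj_ptP (i := i)); rewrite xi oner_neq0.
  - by move=> P' [pP' _]; exact: proj_pt_maximal.
  - by rewrite -xd; exact: residue_field_order.
apply: card_eq_trans (card_eq_pred D).
apply: inj_card_eq => x y; rewrite !inE => /andP[rx /andP[xn _]] /andP[ry /andP[yn _]] xy.
have := pt_fconnect xn yn xy; rewrite -(root_connect (fconnect_sym ffrob_inj)).
by rewrite (eqP rx) (eqP ry) => /eqP.
Qed.
End Orbits.

Lemma prime_power_field_card (K : finFieldType) :
  exists p d, [/\ prime p, (0 < d)%N & #|K| = (p ^ d)%N].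
Proof.
have [p pp pK] := finPcharP K.
exists p, (logn p #|K|); split => //; last exact: card_pprimeChar pK.
rewrite lt0n; apply: contraTneq (card_finNzRing_gt1 K) => ee.
by rewrite (card_pprimeChar pK) ee.
Qed.

Lemma closed_points_prime_power n (SS : {set {set 'I_n}}) q P :
  closed_points_of_norm (supported SS) q P ->
  exists p d, [/\ prime p, (0 < d)%N & q = (p ^ d)%N].
Proof.
move=> [[projP _] _ Pq]; have [i Pi] : exists j, ~ P 'X_j by case: projP.
have [K [_ [_ _ _ <-]]] := proj_point_pt projP Pi Pq.
exact: prime_power_field_card.
Qed.

Lemma closed_points_count n (SS : {set {set 'I_n}}) :
  exists B : nat -> nat, [/\
    forall q, (closed_points_of_norm (supported SS) q #= `I_(B q))%card,
    forall q, B q != 0%N -> exists p d, [/\ prime p, (0 < d)%N & q = (p ^ d)%N] &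
    forall p m, prime p -> (0 < m)%N ->
      (\sum_(d <- divisors m) B (p ^ d)%N * d =
       \sum_(S in SS | S != finset.set0) (p ^ m).-1 ^ (#|S|.-1))%N].
Proof.
have ex q : exists b, (closed_points_of_norm (supported SS) q #= `I_b)%card.
  have [->|/set0P[P /closed_points_prime_power[p [d [pp d0 ->]]]]] :=
    eqVneq (closed_points_of_norm (supported SS) q) set0; first by exists 0%N; rewrite II0.
  (* The field with [q] elements itself serves here, with [m = d]. *)
  have [F pF cF] := pPrimePowerField pp d0.
  by have [b bP _] := card_closed_points SS pF cF d0 (dvdnn d); exists b.
have [B BP] := choice ex; exists B; split => // [q|p m pp m0].
  move=> Bq; have /set0P[P] : closed_points_of_norm (supported SS) q != set0.
    apply: contra_neq Bq => e; apply/esym/card_eq_II.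
    by apply: card_eq_trans (BP q); rewrite e II0.
  exact: closed_points_prime_power.
have [F pF cF] := pPrimePowerField pp m0.
rewrite -cF -card_normalised.
transitivity (\sum_(d <- divisors m)
    \sum_(x in normalised SS F) (order (ffrob p) x == d : nat))%N.
  rewrite big_seq [RHS]big_seq; apply: eq_bigr => d; rewrite -dvdn_divisors// => dm.
  have [b bP bd] := card_closed_points SS pF cF m0 dm.
  have -> : B (p ^ d)%N = b by apply/card_eq_II; apply: card_eq_trans bP; exact/card_esym.
  by rewrite bd -sum1_card big_mkcondr.
(* A vector contributes to the single term where [d] is its order, and this term occurs because the
   order divides [m]. *)
rewrite exchange_big /= -sum1_card; apply: eq_bigr => x _.
under eq_bigr do rewrite eq_sym.
rewrite -big_mkcond sum1_count count_uniq_mem ?divisors_uniq// -dvdn_divisors//.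
by rewrite (order_dvd pF cF).
Qed.

Definition loose_supports (G : loose_graph) : {set {set 'I_#|cvertex G|}} :=
  finset (fun S : {set 'I_#|cvertex G|} =>
    [exists v : vertex G, (enum_rank (inl v : cvertex G) \in S) &&
      [forall w : cvertex G, [&& w != inl v & ~~ cadjacent w (inl v)] ==>
        (enum_rank w \notin S)]]
    || [exists e : edge G, (nb_ends e == 0%N) &&
      [forall w : cvertex G, cincident w e == (enum_rank w \in S)]]).

(** The conditions defining the pieces only bear on which coordinates vanish. A support met in
    several pieces occurs once in the set [loose_supports], so overlaps are not counted twice. *)
Lemma loose_scheme_supported G : loose_scheme G = supported (loose_supports G).
Proof.
have inP P (w : cvertex G) : (enum_rank w \in vsupport P) <-> ~ P (coordX w).
  by rewrite inE; split=> [/negP h /asboolP|h]//; apply/negP => /asboolP.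
apply/seteqP; split=> P.
  case=> [[v _ [pP Pv Pw]]|[e e0 [pP Pe Pw]]]; split => //; rewrite inE; apply/orP.
    left; apply/existsP; exists v; apply/andP; split; first exact/inP.
    apply/forallP => w; apply/implyP => /andP[wv wa]; apply/negP => /inP; apply.
    exact: Pw.
  right; apply/existsP; exists e; apply/andP; split; first exact/eqP.
  apply/forallP => w; apply/eqP; apply/idP/idP => [/Pe/inP//|/inP h].
  by apply/negPn/negP => /Pw.
move=> [pP]; rewrite inE => /orP[/existsP[v /andP[/inP Pv /forallP Pw]]|].
  left; exists v => //; split => // w wv wa.
  have := Pw w; rewrite wv wa /= => /negP h.
  by apply: contrapT => Pw'; apply: h; exact/inP.
move=> /existsP[e /andP[/eqP e0 /forallP h]]; right; exists e => //; split => // w we.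
  by apply/inP; rewrite -(eqP (h w)).
by apply: contrapT => /inP; rewrite -(eqP (h w)); exact/negP.
Qed.

(** * The complex exponential *)

Local Open Scope complex_scope.

Arguments cexp : simpl never.
Arguments npow : simpl never.

Notation normc := ComplexField.Normc.normc.

Section Complex.
Variable R : realType.
Implicit Types (z w : R[i]) (x y : R).

Lemma normcE z : `|z| = (normc z)%:C.
Proof. by []. Qed.

Lemma normc_ge0 z : 0 <= normc z. Proof. by case: z => a b; exact: sqrtr_ge0. Qed.
Lemma normcM z w : normc (z * w) = normc z * normc w.
Proof. exact: ComplexField.Normc.normcM. Qed.
Lemma normcD z w : normc (z + w) <= normc z + normc w. Proof. exact: le_normcD. Qed.
Lemma normcN z : normc (- z) = normc z. Proof. exact: complex.normcN. Qed.
Lemma normcV z : normc z^-1 = (normc z)^-1. Proof. exact: ComplexField.Normc.normcV. Qed.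
Lemma normc1 : normc (1 : R[i]) = 1. Proof. exact: ComplexField.Normc.normc1. Qed.
Lemma normc0 : normc (0 : R[i]) = 0. Proof. exact: ComplexField.Normc.normc0. Qed.
Lemma normcX z n : normc (z ^+ n) = normc z ^+ n.
Proof. by elim: n => [|n IH]; rewrite ?normc1// !exprS normcM IH. Qed.
Lemma normc_real x : normc x%:C = `|x|.
Proof. by rewrite /= expr0n /= addr0 sqrtr_sqr. Qed.
Lemma normc_nat n : normc (n%:R : R[i]) = n%:R.
Proof. by rewrite -(rmorph_nat (real_complex R)) normc_real ger0_norm. Qed.
Lemma normc_Re z : `|complex.Re z| <= normc z.
Proof. by case: z => a b /=; rewrite -sqrtr_sqr ler_wsqrtr// lerDl sqr_ge0. Qed.
Lemma normc_Im z : `|complex.Im z| <= normc z.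
Proof. by case: z => a b /=; rewrite -sqrtr_sqr ler_wsqrtr// lerDr sqr_ge0. Qed.
Lemma normc_le z : normc z <= `|complex.Re z| + `|complex.Im z|.
Proof.
case: z => a b /=; rewrite -[leRHS]ger0_norm ?addr_ge0// -sqrtr_sqr ler_wsqrtr//.
by rewrite sqrrD !real_normK ?num_real// -addrA lerD2l lerDr mulrn_wge0// mulr_ge0.
Qed.
Lemma normc_sum (I : Type) (r : seq I) (P : pred I) (F : I -> R[i]) :
  normc (\sum_(i <- r | P i) F i) <= \sum_(i <- r | P i) normc (F i).
Proof.
elim/big_ind2: _ => [|z x w y zx wy|//]; first by rewrite normc0.
by apply: le_trans (normcD _ _) _; exact: lerD.
Qed.

(** The norm of [R[i]] has its values in [R[i]]; [normc] reduces convergence to real sequences,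
    where squeezing applies. *)
Lemma cvg_normc (f : nat -> R[i]) z :
  (normc (f n - z) @[n --> \oo] --> (0 : R)) -> (f : nat -> R[i]^o) @ \oo --> (z : R[i]^o).
Proof.
move=> h; apply/cvgrPdistC_lt => e e0.
have eE : e = (complex.Re e)%:C by rewrite RRe_real// gtr0_real.
have : 0 < complex.Re e by rewrite -ltcR -eE.
move=> e0'; move/cvgr0Pnorm_lt: h => /(_ _ e0'); apply: filterS => n.
by rewrite ger0_norm ?normc_ge0// => h; rewrite eE normcE ltcR.
Qed.

Lemma cvg_normc0 (f : nat -> R[i]) z :
  (f : nat -> R[i]^o) @ \oo --> (z : R[i]^o) -> (normc (f n - z) @[n --> \oo] --> (0 : R)).
Proof.
move=> /cvgrPdistC_lt h; apply/cvgr0Pnorm_lt => e e0.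
have : (0 : R[i]) < e%:C by rewrite ltcR.
move=> /h; apply: filterS => n hn.
by rewrite ger0_norm ?normc_ge0// -ltcR -normcE.
Qed.

Lemma cexpD z w : cexp (z + w) = cexp z * cexp w.
Proof.
case: z w => [a b] [c d]; rewrite /cexp /= expRD cosD sinD.
by apply/eqP; rewrite eq_complex /=; apply/andP; split; apply/eqP; ring.
Qed.

Lemma cexp0 : cexp 0 = 1 :> R[i].
Proof. by rewrite /cexp /= expR0 cos0 sin0 mul1r. Qed.

Lemma cexp_neq0 z : cexp z != 0.
Proof.
apply/eqP => h; have := cexpD z (- z); rewrite subrr cexp0 h mul0r => /eqP.
by rewrite oner_eq0.
Qed.

Lemma cexpN z : cexp (- z) = (cexp z)^-1.
Proof. by apply: (mulfI (cexp_neq0 z)); rewrite -cexpD subrr cexp0 divff ?cexp_neq0. Qed.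

Lemma cexp_sum (I : Type) (r : seq I) (P : pred I) (F : I -> R[i]) :
  cexp (\sum_(i <- r | P i) F i) = \prod_(i <- r | P i) cexp (F i).
Proof. exact: (big_morph (@cexp R) cexpD cexp0). Qed.

Lemma cexpMn z n : cexp (z *+ n) = cexp z ^+ n.
Proof. by elim: n => [|n IH]; rewrite ?cexp0// mulrS cexpD IH exprS. Qed.

Lemma normc_cexp z : normc (cexp z) = expR (complex.Re z).
Proof.
rewrite /cexp normcM normc_real ger0_norm ?expR_ge0// /= cos2Dsin2 sqrtr1 mulr1//.
Qed.

Lemma cexp_intmul z (a : int) : cexp (z *~ a) = cexp z ^ a.
Proof.
case: a => n; first by rewrite -pmulrn cexpMn.
by rewrite NegzE mulrNz cexpN -pmulrn cexpMn -exprnN.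
Qed.
End Complex.

(** * Elementary factors; [log_sum] is the Taylor polynomial of [- log (1 - z)] at 0 *)

Definition log_sum (K : fieldType) (z : K) N : K := \sum_(1 <= n < N.+1) z ^+ n / n%:R.

Section Factor.
Variable R : realType.
Implicit Types (z : R[i]) (u v A B : {poly R}).

(** On the segment from 0 to [z] the complex function becomes a pair of real polynomials, open to
    real calculus, and its derivative is a geometric sum. *)
Lemma log_sum_poly z N : exists u v,
  (forall t : R, u.[t] +i* v.[t] = log_sum (t%:C * z) N) /\
  (forall t : R, u^`().[t] +i* v^`().[t] = \sum_(n < N) t%:C ^+ n * z ^+ n.+1).
Proof.
elim: N => [|N [u [v [uv duv]]]].
  exists 0, 0; split=> t; last by rewrite deriv0 horner0 big_ord0.
  by rewrite horner0 /log_sum big_geq.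
pose c := z ^+ N.+1.
exists (u + (complex.Re c / N.+1%:R) *: 'X^(N.+1)),
  (v + (complex.Im c / N.+1%:R) *: 'X^(N.+1)); split=> t.
  rewrite /log_sum big_nat_recr//= -/(log_sum _ N) -uv !hornerE.
  rewrite exprMn -/c -rmorphXn -(rmorph_nat (real_complex R)) -(fmorphV (real_complex R)).
  case: c => a b; apply/eqP; rewrite eq_complex /=; apply/andP; split; apply/eqP; by field.
rewrite big_ord_recr /= -duv -/c !derivD !derivZ !derivXn !hornerE -rmorphXn.
rewrite !hornerMn !hornerE -[X in X *+ _]mulr1.
have N0 : N.+1%:R != 0 :> R by [].
case: c => a b; apply/eqP; rewrite eq_complex /=.
by apply/andP; split; apply/eqP; rewrite -(mulr_natl _ N.+1); field.
Qed.

Lemma is_derive_exp_cos_sin u v A B (t : R) :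
  is_derive t 1 (fun x => expR u.[x] * (A.[x] * cos v.[x] + B.[x] * sin v.[x]))
    (expR u.[t] * ((A^`().[t] + u^`().[t] * A.[t] + v^`().[t] * B.[t]) * cos v.[t]
      + (B^`().[t] + u^`().[t] * B.[t] - v^`().[t] * A.[t]) * sin v.[t])).
Proof.
have du : is_derive t 1 (fun x => u.[x]) u^`().[t] by exact: is_derive_poly.
have dv : is_derive t 1 (fun x => v.[x]) v^`().[t] by exact: is_derive_poly.
have dA : is_derive t 1 (fun x => A.[x]) A^`().[t] by exact: is_derive_poly.
have dB : is_derive t 1 (fun x => B.[x]) B^`().[t] by exact: is_derive_poly.
have de := is_derive1_comp (is_derive_expR u.[t]) du.
have dc := is_derive1_comp (is_derive_cos v.[t]) dv.
have ds := is_derive1_comp (is_derive_sin v.[t]) dv.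
have := is_deriveM de (is_deriveD (is_deriveM dA dc) (is_deriveM dB ds)).
move=> /is_derive_eq; apply.
rewrite /= /GRing.scale /=.
rewrite !fctE /=; ring.
Qed.

(* The real and imaginary parts of [(a + i b) cexp (u + i v)] have this form. *)
Lemma exp_cos_sin_MVT u v A B (M : R) :
  (forall t, t \in `]0, 1[ -> expR u.[t] <= expR 1 /\
    `|A^`().[t] + u^`().[t] * A.[t] + v^`().[t] * B.[t]| <= M /\
    `|B^`().[t] + u^`().[t] * B.[t] - v^`().[t] * A.[t]| <= M) ->
  `|expR u.[1] * (A.[1] * cos v.[1] + B.[1] * sin v.[1]) -
    expR u.[0] * (A.[0] * cos v.[0] + B.[0] * sin v.[0])| <= 2 * expR 1 * M.
Proof.
move=> h; have dG t := is_derive_exp_cos_sin u v A B t.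
pose G (x : R) := expR u.[x] * (A.[x] * cos v.[x] + B.[x] * sin v.[x]).
have cG : {within `[0, 1], continuous G}.
  apply: continuous_subspaceT => t; apply: differentiable_continuous.
  by apply/derivable1_diffP; case: (dG t).
have [c c01] := MVT (@ltr01 R) (fun t _ => dG t) cG.
rewrite subr0 mulr1 => ->; have [h1 [h2 h3]] := h _ c01.
have -> : 2 * expR 1 * M = expR 1 * (M + M) by ring.
rewrite normrM ger0_norm ?expR_ge0//; apply: ler_pM => //; rewrite ?expR_ge0//.
apply: le_trans (ler_normD _ _) _; rewrite !normrM; apply: lerD.
  by apply: le_trans h2; rewrite ler_piMr// cos_max.
by apply: le_trans h3; rewrite ler_piMr// sin_max.
Qed.

Lemma log_sum_le1 z N : normc z <= 2^-1 -> normc (log_sum z N) <= 1.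
Proof.
(* The geometric sum of the [2 ^ (- n)] for [1 <= n <= N], a bound that induction can carry. *)
move=> z2; apply: (@le_trans _ _ (1 - 2^-1 ^+ N)); last by rewrite gerBl exprn_ge0.
rewrite /log_sum; elim: N => [|N IH]; first by rewrite big_geq// normc0 subrr.
rewrite big_nat_recr//=; apply: le_trans (normcD _ _) _.
apply: (@le_trans _ _ (1 - 2^-1 ^+ N + 2^-1 ^+ N.+1)); last first.
  by rewrite exprS; lra.
apply: lerD => //; rewrite normcM normcX normcV normc_nat.
rewrite ler_pdivrMr ?ltr0n// -[leLHS]mulr1; apply: ler_pM => //.
- by rewrite exprn_ge0 ?normc_ge0.
- by apply: lerXn2r; rewrite ?nnegrE ?normc_ge0.
- by rewrite ler1n.
Qed.

(* The derivative of [(1 - t z) cexp (log_sum (t z) N)] with respect to the real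
   variable [t] is [- z (t z) ^ N cexp (log_sum (t z) N)]. *)
Lemma elementary_factor_bound z N : normc z <= 2^-1 ->
  normc ((1 - z) * cexp (log_sum z N) - 1) <= 4 * expR 1 * normc z ^+ N.+1.
Proof.
move=> z2; have [u [v [uv duv]]] := log_sum_poly z N.
pose a := complex.Re z; pose b := complex.Im z.
have zE : z = a +i* b by rewrite /a /b; case: (z).
pose D (t : R) := - z * (t%:C * z) ^+ N.
have DE t : D t = - z + (u^`().[t] +i* v^`().[t]) * (1 - t%:C * z).
  rewrite duv; under eq_bigr do rewrite exprS mulrCA -exprMn.
  have S := subrX1 (t%:C * z) N; rewrite -mulr_sumr /D; move: S.
  set y := t%:C * z; set T := \sum_(_ < _) _ => S.
  have -> : y ^+ N = 1 + (y - 1) * T by rewrite -S addrC subrK.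
  by ring.
have DM t : t \in `]0, 1[ -> normc (D t) <= normc z ^+ N.+1.
  rewrite in_itv /= => /andP[t0 t1]; rewrite /D normcM normcN normcX normcM exprS.
  rewrite ler_wpM2l ?normc_ge0// lerXn2r ?nnegrE ?mulr_ge0 ?normc_ge0//.
  by rewrite normc_real gtr0_norm// ler_piMl ?normc_ge0 ?ltW.
have Du t : t \in `]0, 1[ -> expR u.[t] <= expR 1.
  rewrite in_itv /= => /andP[t0 t1]; rewrite ler_expR.
  have -> : u.[t] = complex.Re (log_sum (t%:C * z) N) by rewrite -uv.
  apply: le_trans (ler_norm _) _; apply: le_trans (normc_Re _) _.
  apply: log_sum_le1; apply: le_trans z2; rewrite normcM normc_real gtr0_norm//.
  by rewrite ler_piMl ?normc_ge0 ?ltW.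
have ReD t : complex.Re (D t) = - a + u^`().[t] * (1 - a * t) + v^`().[t] * (b * t).
  by rewrite DE zE /=; ring.
have ImD t : complex.Im (D t) = - b - u^`().[t] * (b * t) + v^`().[t] * (1 - a * t).
  by rewrite DE zE /=; ring.
have [u0 v0] : u.[0] = 0 /\ v.[0] = 0.
  have := uv 0; rewrite rmorph0 mul0r /log_sum big1_seq; first by case.
  by move=> [|n]; rewrite ?mem_index_iota// expr0n mul0r.
(* The two pairs of polynomials come from multiplying [(1 - a t) - i b t] by [cos v + i sin v]: one
   for the real part, one for the imaginary part. *)
have h1 := @exp_cos_sin_MVT u v (1 - a *: 'X) (b *: 'X) (normc z ^+ N.+1).
have h2 := @exp_cos_sin_MVT u v (- b *: 'X) (1 - a *: 'X) (normc z ^+ N.+1).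
have G : (1 - z) * cexp (log_sum z N) - 1 =
   (expR u.[1] * ((1 - a) * cos v.[1] + b * sin v.[1]) - 1) +i*
   (expR u.[1] * (- b * cos v.[1] + (1 - a) * sin v.[1])).
  have := uv 1; rewrite rmorph1 mul1r => <-; rewrite /cexp zE.
  by apply/eqP; rewrite eq_complex /=; apply/andP; split; apply/eqP; ring.
(* The constant 4 is [2 + 2], the mean value bound being used once for each part. *)
have -> : 4 * expR 1 * normc z ^+ N.+1 =
  2 * expR 1 * normc z ^+ N.+1 + 2 * expR 1 * normc z ^+ N.+1 by ring.
apply: le_trans (normc_le _) _; rewrite G /=; apply: lerD.
  have -> : expR u.[1] * ((1 - a) * cos v.[1] + b * sin v.[1]) - 1 =
      expR u.[1] * ((1 - a *: 'X).[1] * cos v.[1] + (b *: 'X).[1] * sin v.[1]) -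
      expR u.[0] * ((1 - a *: 'X).[0] * cos v.[0] + (b *: 'X).[0] * sin v.[0]).
    by rewrite u0 v0 expR0 cos0 sin0 !hornerE /=; ring.
  apply: h1 => t t01; split; first exact: Du.
  rewrite !poly.derivE !hornerE /=; split.
    apply: le_trans (DM _ t01); apply: le_trans (normc_Re _).
    by rewrite ReD le_eqVlt; apply/orP; left; apply/eqP; congr (`|_|); ring.
  apply: le_trans (DM _ t01); apply: le_trans (normc_Im _).
  by rewrite ImD -normrN le_eqVlt; apply/orP; left; apply/eqP; congr (`|_|); ring.
have -> : expR u.[1] * (- b * cos v.[1] + (1 - a) * sin v.[1]) =
    expR u.[1] * ((- b *: 'X).[1] * cos v.[1] + (1 - a *: 'X).[1] * sin v.[1]) -
    expR u.[0] * ((- b *: 'X).[0] * cos v.[0] + (1 - a *: 'X).[0] * sin v.[0]).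
  by rewrite u0 v0 expR0 cos0 sin0 !hornerE /=; ring.
apply: h2 => t t01; split; first exact: Du.
rewrite !poly.derivE !hornerE /=; split.
  apply: le_trans (DM _ t01); apply: le_trans (normc_Im _).
  by rewrite ImD le_eqVlt; apply/orP; left; apply/eqP; congr (`|_|); ring.
apply: le_trans (DM _ t01); apply: le_trans (normc_Re _).
by rewrite ReD le_eqVlt; apply/orP; left; apply/eqP; congr (`|_|); ring.
Qed.
End Factor.

(** * Dirichlet series *)

Section Npow.
Variable R : realType.
Implicit Types (s t : R[i]) (x d : R).

Lemma npow1 s : npow 1 s = 1.
Proof. by rewrite /npow ln1 mul0r cexp0. Qed.

Lemma npowM m n s : (0 < m)%N -> (0 < n)%N -> npow (m * n) s = npow m s * npow n s.
Proof.
move=> m0 n0; rewrite /npow natrM lnM ?posrE ?ltr0n//.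
by rewrite rmorphD mulrDl cexpD.
Qed.

Lemma npowX n k s : (0 < n)%N -> npow (n ^ k) s = npow n s ^+ k.
Proof.
move=> n0; elim: k => [|k IH]; first by rewrite npow1.
by rewrite expnS npowM ?expn_gt0 ?n0// IH exprS.
Qed.

Lemma npow_nat n k : (0 < n)%N -> npow n k%:R = n%:R ^+ k :> R[i].
Proof.
move=> n0; rewrite /npow mulr_natr cexpMn; congr (_ ^+ _).
rewrite /cexp /= cos0 sin0 lnK ?posrE ?ltr0n//.
by rewrite mulr1 rmorph_nat.
Qed.

Lemma npowD n s t : npow n (s + t) = npow n s * npow n t :> R[i].
Proof. by rewrite /npow mulrDr cexpD. Qed.

Lemma normc_npow n s : normc (npow n s) = expR (complex.Re s * ln n%:R).
Proof. by rewrite normc_cexp; case: s => a b /=; rewrite mul0r subr0 mulrC. Qed.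

Lemma ln_nat_ge0 n : 0 <= ln (n%:R : R).
Proof. by case: n => [|n]; [rewrite ln0|rewrite ln_ge0// ler1n]. Qed.

(** The comparison of [x ^ (- (1 + d))] with its primitive, in a discrete form that makes tails
    telescope. It follows from [ln (k + 1) - ln k >= 1 / (k + 1)] and [expR x >= 1 + x]. *)
Lemma p_series_step d k : 0 < d -> (0 < k)%N ->
  d * expR (- (1 + d) * ln k.+1%:R) <= expR (- d * ln k%:R) - expR (- d * ln k.+1%:R).
Proof.
move=> d0 k0; have k0' : 0 < k%:R :> R by rewrite ltr0n.
have k1' : 0 < k.+1%:R :> R by rewrite ltr0n.
have -> : expR (- (1 + d) * ln k.+1%:R) = expR (- d * ln k.+1%:R) / k.+1%:R.
  by rewrite opprD mulrDl mulN1r addrC expRD expRN lnK.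
have xy : ln k%:R <= ln k.+1%:R - k.+1%:R^-1 :> R.
  have -> : k%:R = k.+1%:R * (1 + - k.+1%:R^-1) :> R.
    by rewrite mulrBr mulr1 divff ?gt_eqF// -natr1 addrK.
  have h : -1 < - k.+1%:R^-1 :> R.
    by rewrite ltrN2 invf_lt1// ltr1n.
  rewrite lnM ?posrE//; last by rewrite -ltrBlDl sub0r.
  by rewrite lerD2l; exact: le_ln1Dx.
set y := ln k.+1%:R in xy *; set x := ln k%:R in xy *.
have -> : expR (- d * x) = expR (- d * y) * expR (d * (y - x)).
  by rewrite -expRD; congr expR; ring.
have E0 := expR_gt0 (- d * y); have := expR_ge1Dx (d * (y - x)).
set E := expR (- d * y) in E0 *; set X := expR _; set i := _^-1 in xy *.
have : d * i <= d * (y - x) by rewrite ler_pM2l//; lra.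
move=> h1 h2; have h3 : d * i <= X - 1 by lra.
have : E * (d * i) <= E * (X - 1) by rewrite ler_pM2l.
by rewrite mulrBr mulr1 mulrCA.
Qed.

Lemma p_series_tail d Q M : 0 < d -> (0 < Q)%N ->
  \sum_(Q.+1 <= n < M.+1) expR (- (1 + d) * ln n%:R) <= expR (- d * ln Q%:R) / d.
Proof.
move=> d0 Q0; rewrite ler_pdivlMr// mulrC mulr_sumr.
have [QM|MQ] := leqP Q M; last by rewrite big_geq ?expR_ge0 ?leqW.
apply: (@le_trans _ _ (expR (- d * ln Q%:R) - expR (- d * ln M%:R))); last first.
  by rewrite gerBl expR_ge0.
elim: M QM => [|M IH].
  by rewrite leqn0 => /eqP Q0'; rewrite Q0' in Q0.
rewrite leq_eqVlt => /orP[/eqP <-|]; first by rewrite big_geq// subrr.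
rewrite ltnS => QM; rewrite big_nat_recr//=.
have := lerD (IH QM) (p_series_step d0 (leq_trans Q0 QM)).
by rewrite addrA subrK.
Qed.

Lemma expR_ln_cvg0 d : 0 < d -> (expR (- d * ln n%:R) @[n --> \oo] --> (0 : R)).
Proof.
move=> d0; apply/cvgr0Pnorm_lt => e e0; near=> n.
rewrite ger0_norm ?expR_ge0// -[ltRHS](lnK) ?posrE// ltr_expR.
rewrite mulNr ltrNl -ltr_pdivrMl// -ltr_expR lnK ?posrE; last first.
  by rewrite ltr0n; near: n; exact: nbhs_infty_gt.
by near: n; exact: nbhs_infty_gtr.
Unshelve. all: by end_near. Qed.
End Npow.

Lemma sum_complex (R : realType) (I : Type) (r : seq I) (F : I -> R[i]) :
  \sum_(i <- r) F i = (\sum_(i <- r) complex.Re (F i)) +i* (\sum_(i <- r) complex.Im (F i)).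
Proof.
elim: r => [|i r IH]; first by rewrite !big_nil.
by rewrite !big_cons IH; case: (F i).
Qed.

Lemma cvg_inv_of_mul (K : numFieldType) (z : K) (E : nat -> K^o) : z != 0 ->
  (fun n => z * E n : K^o) @ \oo --> (1 : K^o) ->
  (fun n => (E n)^-1 : K^o) @ \oo --> (z : K^o).
Proof.
move=> z0 h1; have h := @cvgV K _ _ _ _ _ (oner_neq0 _) h1.
have {}h := h eventually_filter.
have H := @cvgM K _ _ _ _ _ _ _ (@cvg_cst K^o (z : K^o) _ _ _) h.
rewrite invr1 mulr1 in H.
have -> : (fun n => (E n)^-1) = (fun n => z * (z * E n)^-1).
  by apply/funext => n; rewrite invfM mulrA divff// mul1r.
exact: H.
Qed.

(** * The Riemann zeta function and its Euler product, by sieving *)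

Section Zeta.
Variables (R : realType) (s : R[i]).
Hypothesis s1 : 1 < complex.Re s.
Let d := complex.Re s - 1.
Let d0 : 0 < d. Proof. by rewrite subr_gt0. Qed.
Let f n : R[i] := npow n (- s).

Let normc_f n : normc (f n) = expR (- (1 + d) * ln n%:R).
Proof.
rewrite normc_npow; suff -> : complex.Re (- s) = - (1 + d) by [].
by rewrite /d addrC subrK; case: (s).
Qed.

(** [riemann_zeta] is a [limn], so its value is usable only once the series is known to converge;
    real and imaginary parts are each dominated by the norms. *)
Lemma zeta_cvg :
  (fun M => \sum_(1 <= n < M.+1) f n : R[i]^o) @ \oo --> (riemann_zeta s : R[i]^o).
Proof.
pose g n : R := normc (f n.+1).
have cg : cvgn (series g).
  apply: nondecreasing_is_cvgn.
    by apply: nondecreasing_series => n _ _; exact: normc_ge0.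
  exists (1 + expR (- d * ln 1%:R) / d) => _ [n _ <-].
  have -> : series g n = \sum_(1 <= k < n.+1) normc (f k).
    by rewrite /series /= big_add1.
  case: n => [|n].
    by rewrite big_geq// addr_ge0// divr_ge0 ?expR_ge0 ?ltW.
  rewrite big_ltn// [f 1%N]npow1 normc1 lerD2l; apply: le_trans (p_series_tail _ d0 _) => //.
  by apply: ler_sum => k _; rewrite normc_f.
have cr (h : R[i] -> R) : (forall z, `|h z| <= normc z) ->
    cvgn (series (fun n => h (f n.+1))).
  move=> hn; apply: normed_cvg; apply: (series_le_cvg _ _ _ cg) => n.
  - exact: normr_ge0.
  - exact: normc_ge0.
  - exact: hn.
have cRe := cr _ (@normc_Re R); have cIm := cr _ (@normc_Im R).
pose l : R[i] := limn (series (fun n => complex.Re (f n.+1))) +i*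
  limn (series (fun n => complex.Im (f n.+1))).
have SE M : \sum_(1 <= n < M.+1) f n = series (fun n => complex.Re (f n.+1)) M +i*
    series (fun n => complex.Im (f n.+1)) M.
  by rewrite big_add1 [LHS]sum_complex.
have cl : (fun M => \sum_(1 <= n < M.+1) f n : R[i]^o) @ \oo --> (l : R[i]^o).
  apply: cvg_normc.
  pose b M := `|series (fun n => complex.Re (f n.+1)) M - complex.Re l| +
    `|series (fun n => complex.Im (f n.+1)) M - complex.Im l|.
  apply: (@squeeze_cvgr _ _ _ _ (fun=> 0) b).
  - by near=> M; rewrite normc_ge0 /= (le_trans (normc_le _))// SE.
  - exact: cvg_cst.
  - rewrite /b -[X in _ --> X](addr0 (0 : R)).
    by apply: cvgD; apply/norm_cvg0P/subr_cvg0; [exact: cRe|exact: cIm].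
suff -> : riemann_zeta s = l by [].
have e := @cvg_lim R[i]^o (@norm_hausdorff _ _) _ _ _ _ _ cl.
rewrite -[RHS]e /riemann_zeta.
have -> // : series (fun n => npow n.+1 (- s)) = (fun M => \sum_(1 <= n < M.+1) f n).
by apply/funext => M; rewrite big_add1.
Unshelve. all: by end_near. Qed.

Lemma riemann_tail Q M : (0 < Q)%N ->
  \sum_(Q.+1 <= n < M.+1) normc (f n) <= expR (- d * ln Q%:R) / d.
Proof.
move=> Q0; apply: le_trans (p_series_tail _ d0 Q0).
by apply: ler_sum => k _; rewrite normc_f.
Qed.

Fixpoint sieved Q n := if Q is Q'.+1 then
  sieved Q' n && (prime Q ==> ~~ (Q %| n)%N) else true.

Lemma sievedP Q n : reflect (forall p, prime p -> (p <= Q)%N -> ~~ (p %| n)%N) (sieved Q n).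
Proof.
elim: Q => [|Q IH]; first by constructor=> p; case: p.
apply: (iffP andP) => [[/IH h hQ] p pp|h].
  rewrite leq_eqVlt => /orP[/eqP pQ|]; last exact: h.
  by rewrite pQ in pp *; rewrite pp in hQ.
by split; [apply/IH => p pp pQ; apply: h => //; exact: leqW|apply/implyP => pp; exact: h].
Qed.

Lemma sum_multiples (V : nmodType) p M (g : nat -> V) : (0 < p)%N ->
  \sum_(1 <= n < M.+1 | (p %| n)%N) g n = \sum_(1 <= k < (M %/ p).+1) g (p * k)%N.
Proof.
move=> p0; elim: M => [|M IH]; first by rewrite div0n !big_geq.
rewrite big_mkcond big_nat_recr//= -big_mkcond IH divnS//.
case: ifP => [pM|_]; last by rewrite add0n addr0.
rewrite add1n [RHS]big_nat_recr//=; congr (_ + g _).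
have := divnK pM; rewrite divnS// pM add1n => <-.
by rewrite mulnC.
Qed.

Let U Q M := \sum_(1 <= n < M.+1 | sieved Q n) f n.

(** The terms removed are those at [n = (Q + 1) * k]. Such an [n] has no prime factor up to [Q]
    exactly when [k] has none, and [npow] is multiplicative. *)
Lemma sieve_step Q M : prime Q.+1 -> U Q.+1 M = U Q M - f Q.+1 * U Q (M %/ Q.+1).
Proof.
move=> pQ; apply/eqP; rewrite eq_sym subr_eq eq_sym addrC; apply/eqP.
have -> : f Q.+1 * U Q (M %/ Q.+1) = \sum_(1 <= n < M.+1 | (Q.+1 %| n)%N && sieved Q n) f n.
  rewrite big_mkcondr /= sum_multiples//.
  rewrite /U mulr_sumr big_mkcond /= big_nat [RHS]big_nat.
  apply: eq_bigr => k /andP[k0 _].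
  have -> : sieved Q (Q.+1 * k) = sieved Q k.
    apply/sievedP/sievedP => h p pp pQ'; have := h _ pp pQ'; rewrite Euclid_dvdM//.
      by rewrite negb_or => /andP[].
    rewrite negb_or => ->; rewrite andbT dvdn_prime2//.
    by apply: contraTneq pQ' => ->; rewrite ltnn.
  by case: ifP => // _; rewrite /f npowM.
rewrite /U [RHS](bigID (fun n => (Q.+1 %| n)%N)) /=; congr (_ + _).
  by apply: eq_bigl => n; rewrite andbC.
by apply: eq_bigl => n; rewrite pQ.
Qed.

(** The reciprocal of the usual partial Euler product: the factor by which the sieve multiplies
    [riemann_zeta s]. *)
Definition euler_product Q : R[i] := \prod_(1 <= p < Q.+1 | prime p) (1 - f p).

Lemma euler_productS Q : euler_product Q.+1 =
  euler_product Q * (if prime Q.+1 then 1 - f Q.+1 else 1).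
Proof. by rewrite /euler_product big_mkcond big_nat_recr // -big_mkcond. Qed.

Lemma sieve_cvg Q : (U Q : nat -> R[i]^o) @ \oo --> (riemann_zeta s * euler_product Q : R[i]^o).
Proof.
elim: Q => [|Q IH]; first by rewrite /euler_product big_geq// mulr1; exact: zeta_cvg.
rewrite euler_productS; case: ifP => pQ; last first.
  rewrite mulr1; suff -> : U Q.+1 = U Q by [].
  by apply/funext => M; apply: eq_bigl => n /=; rewrite pQ andbT.
have -> : U Q.+1 = (fun M => U Q M - f Q.+1 * U Q (M %/ Q.+1)).
  by apply/funext => M; exact: sieve_step.
rewrite mulrA mulrBr mulr1; apply: (@cvgB _ R[i]^o); first exact: IH.
rewrite mulrC; apply: (@cvgM R[i]); first exact: cvg_cst.
apply: (cvg_comp (fun M => M %/ Q.+1)%N (U Q)) IH.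
move=> A [n _ An]; exists (n * Q.+1)%N => // m /= nm; apply: An.
by rewrite /= leq_divRL.
Qed.
(** Any [n] with [1 < n <= Q] has a prime factor at most [Q], so besides the term 1 only terms
    beyond [Q] survive; the bound is uniform in [M]. *)
Lemma sieve_dist Q M : (0 < Q)%N -> (Q <= M)%N ->
  normc (U Q M - 1) <= expR (- d * ln Q%:R) / d.
Proof.
move=> Q0 QM; apply: le_trans (riemann_tail M Q0).
have sieved1 : sieved Q 1 by apply/sievedP => p pp _; rewrite dvdn1 gtn_eqF// prime_gt1.
have -> : U Q M - 1 = \sum_(Q.+1 <= n < M.+1 | sieved Q n) f n.
  rewrite /U (@big_cat_nat _ _ _ Q.+1)//= big_ltn_cond// sieved1 [f 1%N]npow1.
  rewrite big1_seq ?addr0 1?addrC ?addrA ?addNr ?addrK ?add0r//.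
  move=> n /andP[/sievedP h]; rewrite mem_index_iota => /andP[n1 nQ].
  have := h (pdiv n) (pdiv_prime n1).
  by rewrite pdiv_dvd => /(_ (leq_trans (pdiv_leq (ltnW n1)) nQ)).
apply: le_trans (normc_sum _ _ _) _; rewrite big_mkcond; apply: ler_sum => n _.
by case: ifP => // _; exact: normc_ge0.
Qed.

Lemma euler_dist Q : (0 < Q)%N ->
  normc (riemann_zeta s * euler_product Q - 1) <= expR (- d * ln Q%:R) / d.
Proof.
move=> Q0; apply/ler_addgt0Pl => e e0.
have /cvg_normc0/cvgr0Pnorm_lt/(_ _ e0)[N _ /(_ (maxn N Q))] := sieve_cvg (Q := Q).
rewrite /= leq_maxl => /(_ isT); rewrite ger0_norm ?normc_ge0// => h.
rewrite -(subrKA (U Q (maxn N Q))); apply: le_trans (normcD _ _) _.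
by apply: lerD; [rewrite -normcN opprB ltW|exact: sieve_dist (leq_maxr _ _)].
Qed.

Lemma zeta_euler_cvg1 :
  (fun Q => riemann_zeta s * euler_product Q : R[i]^o) @ \oo --> (1 : R[i]^o).
Proof.
apply: cvg_normc; apply: (@squeeze_cvgr _ _ _ _ (fun=> 0) (fun Q => expR (- d * ln Q%:R) / d)).
- near=> Q; rewrite normc_ge0 euler_dist//; near: Q; exact: nbhs_infty_gt.
- exact: cvg_cst.
- rewrite -[X in _ --> X](mul0r d^-1); apply: cvgM; last exact: cvg_cst.
  exact: expR_ln_cvg0.
Unshelve. all: by end_near. Qed.

(** Otherwise products that tend to 1 would all be 0. *)
Lemma zeta_neq0 : riemann_zeta s != 0.
Proof.
apply/eqP => z0; have := zeta_euler_cvg1; rewrite z0.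
under eq_fun do rewrite mul0r.
move=> /(cvg_unique (@norm_hausdorff _ R[i]^o) (@cvg_cst _ (0 : R[i]^o) _ _ _))/eqP.
by rewrite eq_sym oner_eq0.
Qed.

Lemma euler_cvg : (fun Q => (euler_product Q)^-1 : R[i]^o) @ \oo --> (riemann_zeta s : R[i]^o).
Proof.
exact: (@cvg_inv_of_mul R[i] _ _ zeta_neq0 zeta_euler_cvg1).
Qed.
End Zeta.

(** * Euler products *)

Section Products.
Variable R : realType.

(** Bounds of the form [expR e - 1] are stable under products, since [|x y - 1|] is at most
    [(1 + |x - 1|) (1 + |y - 1|) - 1]. *)
Lemma prod_near1 (I : eqType) (r : seq I) (F : I -> R[i]) (e : I -> R) :
  (forall i, i \in r -> normc (F i - 1) <= expR (e i) - 1) ->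
  normc (\prod_(i <- r) F i - 1) <= expR (\sum_(i <- r) e i) - 1.
Proof.
elim: r => [|i r IH] h; first by rewrite !big_nil subrr normc0 expR0 subrr.
rewrite !big_cons expRD; set P := \prod_(_ <- _) _; set S := \sum_(_ <- _) _.
have hP : normc (P - 1) <= expR S - 1.
  by apply: IH => j jr; apply: h; rewrite inE jr orbT.
have hF : normc (F i - 1) <= expR (e i) - 1 by apply: h; rewrite mem_head.
have -> : F i * P - 1 = (F i - 1) * (P - 1) + (F i - 1) + (P - 1) by ring.
have F0 := normc_ge0 (F i - 1); have P0 := normc_ge0 (P - 1).
apply: le_trans (normcD _ _) _.
apply: (@le_trans _ _ (normc (F i - 1) * normc (P - 1) + normc (F i - 1) + normc (P - 1))).
  by rewrite lerD2r; apply: le_trans (normcD _ _) _; rewrite normcM.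
have -> : expR (e i) * expR S - 1 =
  (expR (e i) - 1) * (expR S - 1) + (expR (e i) - 1) + (expR S - 1) by ring.
by apply: lerD => //; apply: lerD => //; apply: ler_pM.
Qed.

Lemma exprn_near1 (x : R[i]) (e : R) n : normc (x - 1) <= e ->
  normc (x ^+ n - 1) <= expR (e *+ n) - 1.
Proof.
move=> h; have := @prod_near1 nat (iota 0 n) (fun=> x) (fun=> e).
rewrite !big_const_seq !count_predT size_iota iter_mulr_1 iter_addr_0; apply.
move=> i _; apply: le_trans h _; rewrite lerBrDl; exact: expR_ge1Dx.
Qed.

Lemma normc_npow_le_half s q : 1 <= complex.Re s -> (1 < q)%N ->
  normc (npow q (- s) : R[i]) <= 2^-1.
Proof.
move=> s1 q1; rewrite normc_npow; case: s s1 => a b /= a1.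
have q0 : (0 : R) < q%:R by rewrite ltr0n ltnW.
apply: (@le_trans _ _ (expR (- ln q%:R))).
  by rewrite ler_expR mulNr lerN2 ler_peMl// ln_nat_ge0.
by rewrite expRN lnK ?posrE// lef_pV2 ?posrE// ler_nat.
Qed.

(** For [q >= 2] and [Q >= 1], [trunc_log q Q] is the largest [n] with [q ^ n <= Q], which gives all
    the factors one common cutoff. *)
Definition corrected_euler_product (B : nat -> nat) (s : R[i]) Q : R[i] :=
  \prod_(2 <= q < Q.+1)
    ((1 - npow q (- s)) * cexp (log_sum (npow q (- s)) (trunc_log q Q))) ^+ B q.

(* With [N = trunc_log q Q], the error [q ^ (- s (N + 1))] of the factor at [q] is
   at most [Q ^ (- d) q ^ (- (m + 1 + d))], because [q ^ (N + 1) > Q]. *)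
Lemma corrected_euler_product_cvg (B : nat -> nat) (s : R[i]) m (C : R) :
  m.+1%:R < complex.Re s ->
  (forall q, (1 < q)%N -> (B q)%:R <= C * q%:R ^+ m) ->
  (corrected_euler_product B s : nat -> R[i]^o) @ \oo --> (1 : R[i]^o).
Proof.
(* Half of the available margin: in [Re s = m + 1 + 2 d], one [d] yields the decay in [Q] and the
   other the convergence of the sum over [q]. *)
move=> sm BC; pose d := (complex.Re s - m.+1%:R) / 2.
have d0 : 0 < d by rewrite divr_gt0// subr_gt0.
have s1 : 1 <= complex.Re s by apply: le_trans (ltW sm); rewrite ler1n.
have [K KE] : {K : R | K = 4 * expR 1} by exists (4 * expR 1).
have K0 : 0 <= K by rewrite KE mulr_ge0 ?expR_ge0.
have C0 : 0 <= C.
  by have := le_trans (ler0n R _) (BC 2 isT); rewrite pmulr_lge0// exprn_gt0.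
pose e Q q : R := (K * normc (npow q (- s)) ^+ (trunc_log q Q).+1) *+ B q.
have eB Q q : (0 < Q)%N -> (1 < q)%N ->
    e Q q <= K * C * expR (- d * ln Q%:R) * expR (- (1 + d) * ln q%:R).
  move=> Q0 q1; have q0 : (0 : R) < q%:R by rewrite ltr0n ltnW.
  rewrite /e -mulr_natr -!mulrA ler_wpM2l//.
  apply: (@le_trans _ _ (expR (- d * ln Q%:R) * expR (- (m.+1%:R + d) * ln q%:R)
     * (C * q%:R ^+ m))).
    apply: ler_pM; rewrite ?ler0n ?exprn_ge0 ?normc_ge0 ?BC//.
    rewrite normc_npow -expRM_natl -expRD ler_expR.
    have -> : complex.Re (- s) = - (m.+1%:R + d + d).
      by rewrite /d; case: (s) => a b /=; field.
    set N := (trunc_log q Q).+1.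
    have lq := ln_nat_ge0 R q; have h1 : ln q%:R <= N%:R * ln q%:R :> R.
      by rewrite ler_peMl// ler1n.
    have h2 : ln Q%:R <= N%:R * ln q%:R :> R.
      rewrite mulr_natl -lnXn// -natrX ler_ln ?posrE ?ltr0n ?expn_gt0 ?(ltnW q1)//.
      by rewrite ler_nat ltnW// trunc_log_ltn.
    have h3 : d * ln Q%:R <= d * (N%:R * ln q%:R) by rewrite ler_pM2l.
    have h4 : (m.+1%:R + d) * ln q%:R <= (m.+1%:R + d) * (N%:R * ln q%:R).
      by rewrite ler_wpM2l// addr_ge0// ltW.
    lra.
  have -> : q%:R ^+ m = expR (m%:R * ln (q%:R : R)).
    by rewrite expRM_natl lnK ?posrE.
  rewrite mulrC -!mulrA ler_wpM2l// mulrCA ler_wpM2l ?expR_ge0// -expRD ler_expR.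
  by rewrite le_eqVlt -mulrDl -natr1; apply/orP; left; apply/eqP; congr (_ * _); ring.
have bound Q : (0 < Q)%N -> normc (corrected_euler_product B s Q - 1) <=
    expR (K * C / d * expR (- d * ln Q%:R)) - 1.
  move=> Q0; apply: le_trans (prod_near1 (e := e Q) _) _.
    move=> q; rewrite mem_index_iota => /andP[q1 _]; apply: exprn_near1.
    by rewrite KE; apply: elementary_factor_bound; exact: normc_npow_le_half.
  rewrite lerB// ler_expR.
  apply: (@le_trans _ _ (\sum_(2 <= q < Q.+1)
     K * C * expR (- d * ln Q%:R) * expR (- (1 + d) * ln q%:R))).
    by rewrite big_nat [leRHS]big_nat; apply: ler_sum => q /andP[q1 _]; exact: eB.
  rewrite -mulr_sumr [leRHS]mulrAC ler_wpM2l ?mulr_ge0 ?expR_ge0//.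
  by apply: le_trans (p_series_tail _ d0 _) _ => //; rewrite ln1 mulr0 expR0 div1r.
apply: cvg_normc; apply: (@squeeze_cvgr _ _ _ _ (fun=> 0)
  (fun Q => expR (K * C / d * expR (- d * ln Q%:R)) - 1)).
- near=> Q; rewrite normc_ge0 bound//; near: Q; exact: nbhs_infty_gt.
- exact: cvg_cst.
- rewrite -[X in _ --> X](subrr 1); apply: cvgB; last exact: cvg_cst.
  rewrite -[X in _ --> X]expR0; apply: continuous_cvg; first exact: continuous_expR.
  rewrite -[X in _ --> X](mulr0 (K * C / d)); apply: cvgM; first exact: cvg_cst.
  exact: expR_ln_cvg0.
Unshelve. all: by end_near. Qed.
End Products.

(** * Exact rearrangement of sums over prime powers *)

Lemma sum_prime_powers_of (V : nmodType) (p Q : nat) (h : nat -> V) : prime p ->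
  \sum_(2 <= q < Q.+1 | q == (p ^ logn p q)%N) h q =
  \sum_(1 <= k < (trunc_log p Q).+1) h (p ^ k)%N.
Proof.
move=> pp; have p1 := prime_gt1 pp.
rewrite -big_filter -(big_map (expn p) xpredT h).
apply: perm_big; apply: uniq_perm.
- by rewrite filter_uniq ?iota_uniq.
- by rewrite map_inj_uniq ?iota_uniq// => i j /eqP; rewrite eqn_exp2l// => /eqP.
move=> q; rewrite mem_filter mem_index_iota; apply/andP/mapP => [[/eqP qE /andP[q2 qQ]]|].
  exists (logn p q) => //; rewrite mem_index_iota ltnS trunc_log_max// -?qE// andbT.
  by rewrite lt0n; apply: contraTneq q2 => l0; rewrite qE l0.
move=> [k]; rewrite mem_index_iota ltnS => /andP[k1 kQ] ->.
rewrite pfactorK// eqxx ltnS; split=> //.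
have Q0 : (0 < Q)%N.
  by rewrite lt0n; apply: contraTneq kQ => ->; rewrite trunc_log0 -ltnNge.
apply/andP; split; first by rewrite -(expn0 p) ltn_exp2l.
by apply: leq_trans (trunc_logP p1 Q0); rewrite leq_exp2l.
Qed.

Lemma sum_prime_powers (V : nmodType) (Q : nat) (h : nat -> V) :
  (forall q, ~ (exists p k, [/\ prime p, (0 < k)%N & q = (p ^ k)%N]) -> h q = 0) ->
  \sum_(2 <= q < Q.+1) h q =
  \sum_(1 <= p < Q.+1 | prime p) \sum_(1 <= k < (trunc_log p Q).+1) h (p ^ k)%N.
Proof.
move=> h0.
under [RHS]eq_bigr => p pp do rewrite -sum_prime_powers_of// big_mkcond.
rewrite exchange_big /= big_nat [RHS]big_nat; apply: eq_bigr => q /andP[q2 qQ].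
have [[p [k [pp k0 qE]]]|/h0 ->] := pselect (exists p k, [/\ prime p, (0 < k)%N & q = (p ^ k)%N]);
  last by rewrite big1// => p _; case: ifP.
have pQ : p \in index_iota 1 Q.+1.
  rewrite mem_index_iota prime_gt0//= (leq_ltn_trans _ qQ)// qE -{1}(expn1 p).
  by rewrite leq_exp2l// prime_gt1.
rewrite big_mkcond (bigD1_seq p)//= ?iota_uniq// pp qE pfactorK// eqxx big1 ?addr0// => l lp.
case: ifP => // pl; case: eqP => // e; exfalso; move/eqP: lp; apply.
have : (l %| p ^ k)%N.
  rewrite e; apply: dvdn_exp => //; rewrite lt0n; apply/eqP => l0.
  move: e; rewrite l0 expn0 => /eqP; rewrite -(expn0 p) eqn_exp2l ?prime_gt1//.
  by rewrite gtn_eqF.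
by rewrite Euclid_dvdX// k0 andbT dvdn_prime2// => /eqP.
Qed.

(** Ensures that [n] is within the cutoff for [p ^ k] exactly when [k * n] is within the cutoff for
    [p]. *)
Lemma trunc_log_exp p k Q : (1 < p)%N -> (0 < k)%N -> (0 < Q)%N ->
  trunc_log (p ^ k) Q = (trunc_log p Q %/ k)%N.
Proof.
move=> p1 k0 Q0; apply: trunc_log_eq.
  by rewrite -(exp1n k) ltn_exp2r.
rewrite -!expnM; apply/andP; split.
  apply: leq_trans (trunc_logP p1 Q0); rewrite leq_exp2l// mulnC.
  exact: leq_divM.
apply: leq_trans (trunc_log_ltn Q p1) _; rewrite leq_exp2l// mulnC.
exact: ltn_ceil.
Qed.

Lemma perm_divisors m N : (0 < m <= N)%N ->
  perm_eq (divisors m) [seq d <- index_iota 1 N.+1 | (d %| m)%N].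
Proof.
move=> /andP[m0 mN]; apply: uniq_perm; rewrite ?divisors_uniq ?filter_uniq ?iota_uniq//.
move=> d; rewrite -dvdn_divisors// mem_filter mem_index_iota; apply/idP/andP => [dm|[]//].
by rewrite dm (dvdn_gt0 m0 dm) ltnS (leq_trans _ mN)// dvdn_leq.
Qed.

(** With [m = k * n], the term [y ^ (k * n) / n] is [k * y ^ m / m], and the cutoff depends on [m]
    only; for each [m] the sum then runs over all divisors [k]. *)
Lemma log_sum_divisors (K : numFieldType) (p Q : nat) (y : K) (B : nat -> nat) :
  prime p ->
  \sum_(1 <= k < (trunc_log p Q).+1)
    log_sum (y ^+ k) (trunc_log (p ^ k) Q) *+ B (p ^ k)%N =
  \sum_(1 <= m < (trunc_log p Q).+1)
    y ^+ m / m%:R * (\sum_(d <- divisors m) B (p ^ d) * d)%N%:R.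
Proof.
move=> pp; have p1 := prime_gt1 pp; set N := trunc_log p Q.
have [N0|N0] := posnP N; first by rewrite N0 !big_geq.
have Q0 : (0 < Q)%N by rewrite lt0n; apply: contraTneq N0 => Q0; rewrite /N Q0 trunc_log0.
transitivity (\sum_(1 <= k < N.+1) \sum_(1 <= m < N.+1 | (k %| m)%N)
    (y ^+ m / m%:R * (B (p ^ k)%N * k)%:R)).
  rewrite big_nat [RHS]big_nat; apply: eq_bigr => k /andP[k0 _].
  rewrite sum_multiples// trunc_log_exp// /log_sum -sumrMnl.
  rewrite big_nat [RHS]big_nat; apply: eq_bigr => n /andP[n0 _].
  rewrite -mulr_natr -exprM !natrM invfM.
  have k0' : k%:R != 0 :> K by rewrite pnatr_eq0 -lt0n.
  have n0' : n%:R != 0 :> K by rewrite pnatr_eq0 -lt0n.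
  by field; rewrite n0' k0'.
under eq_bigr do rewrite big_mkcond.
rewrite exchange_big /= big_nat [RHS]big_nat; apply: eq_bigr => m /andP[m0 mN].
rewrite -big_mkcond -mulr_sumr -natr_sum; congr (_ * _%:R).
rewrite -big_filter; apply: perm_big; rewrite perm_sym; apply: perm_divisors.
by rewrite m0.
Qed.

(** When [z p] is [p ^ (- s)], the factor [p ^ j] shifts [s] to [s - j], which is how powers of [p]
    in the point count become shifts of zeta. *)
Lemma log_sum_prime_powers (K : numFieldType) (Q : nat) (z : nat -> K)
    (B : nat -> nat) m (a : 'I_m.+1 -> int) :
  (forall p k, prime p -> z (p ^ k)%N = z p ^+ k) ->
  (forall q, B q != 0%N -> exists p k, [/\ prime p, (0 < k)%N & q = (p ^ k)%N]) ->
  (forall p k, prime p -> (0 < k)%N ->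
    (\sum_(d <- divisors k) B (p ^ d) * d)%N%:Z =
    \sum_(j < m.+1) a j * ((p ^ k) ^ j)%N%:Z) ->
  \sum_(2 <= q < Q.+1) log_sum (z q) (trunc_log q Q) *+ B q =
  \sum_(j < m.+1) (\sum_(1 <= p < Q.+1 | prime p)
     log_sum (p%:R ^+ j * z p) (trunc_log p Q)) *~ a j.
Proof.
move=> zX B0 BE.
rewrite (@sum_prime_powers _ Q (fun q => log_sum (z q) (trunc_log q Q) *+ B q)); last first.
  by move=> q hq; have [->|/B0/hq//] := eqVneq (B q) 0%N; rewrite mulr0n.
under [RHS]eq_bigr do rewrite mulrz_suml.
rewrite exchange_big /=; apply: eq_bigr => p pp.
under eq_bigr do rewrite zX//.
rewrite log_sum_divisors//.
under [RHS]eq_bigr do rewrite mulrz_suml.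
rewrite exchange_big /= big_nat [RHS]big_nat; apply: eq_bigr => k /andP[k0 _].
have -> : (\sum_(d <- divisors k) B (p ^ d) * d)%N%:R =
  (\sum_(j < m.+1) a j * ((p ^ k) ^ j)%N%:Z)%:~R :> K by rewrite -BE.
rewrite rmorph_sum mulr_sumr; apply: eq_bigr => j _.
have e : (((p ^ k) ^ j)%N%:Z)%:~R = (p%:R ^+ j) ^+ k :> K.
  by rewrite -pmulrn !natrX -!exprM mulnC.
rewrite rmorphM /= e -mulrzr exprMn; move: (_ ^+ k) (_ ^+ k) => u v.
by ring.
Qed.

Section Limits.
Variable K : numFieldType.

Lemma cvg_exprz (u : nat -> K^o) (l : K) (a : int) : l != 0 ->
  u @ \oo --> (l : K^o) -> (fun n => u n ^ a : K^o) @ \oo --> (l ^ a : K^o).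
Proof.
move=> l0 ul; have h k : (fun n => u n ^+ k : K^o) @ \oo --> (l ^+ k : K^o).
  elim: k => [|k IH]; first exact: (@cvg_cst K^o).
  under eq_fun do rewrite exprS.
  by rewrite exprS; exact: (@cvgM K _ _ _ _ _ _ _ ul IH).
case: a => k; first exact: h.
rewrite NegzE; under eq_fun do rewrite -exprnN.
rewrite -exprnN; apply: (@cvgV K _ _ _ _ _ _ (h k.+1)).
by rewrite expf_neq0.
Qed.

Lemma cvg_prod_exprz n (u : 'I_n -> nat -> K^o) (l : 'I_n -> K) (a : 'I_n -> int) :
  (forall j, l j != 0) -> (forall j, u j @ \oo --> (l j : K^o)) ->
  (fun Q => \prod_j u j Q ^ a j : K^o) @ \oo --> (\prod_j l j ^ a j : K^o).
Proof.
move=> l0 ul; elim: (index_enum _) => [|j r IH].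
  under eq_fun do rewrite big_nil.
  by rewrite big_nil; exact: (@cvg_cst K^o).
under eq_fun do rewrite big_cons.
rewrite big_cons; apply: (@cvgM K _ _ _ _ _ _ _ _ IH).
exact: cvg_exprz.
Qed.

Lemma cvg_mul_cvg1 (u v : nat -> K^o) (l : K) :
  u @ \oo --> (1 : K^o) -> v @ \oo --> (l : K^o) ->
  (fun n => u n * v n : K^o) @ \oo --> (l : K^o).
Proof.
move=> u1 vl; rewrite -(mul1r l).
exact: (@cvgM K _ _ _ _ _ _ _ u1 vl).
Qed.

Lemma cvg_div_cvg1 (u v w : nat -> K^o) (l : K) : (forall n, w n = v n / u n) ->
  u @ \oo --> (1 : K^o) -> v @ \oo --> (l : K^o) -> w @ \oo --> (l : K^o).
Proof.
move=> wE u1 vl; have ui := @cvgV K _ _ _ _ _ (oner_neq0 _) u1.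
have {}ui := ui eventually_filter.
have -> : w = (fun n => v n / u n) by apply/funext.
rewrite -(mulr1 l) -invr1.
exact: (@cvgM K _ _ _ _ _ _ _ vl ui).
Qed.
End Limits.

(** * Comparison of the Euler products *)

Section Final.
Variable R : realType.

Lemma npow_neq1 (s : R[i]) q : 1 <= complex.Re s -> (1 < q)%N -> 1 - npow q (- s) != 0.
Proof.
move=> s1 q1; rewrite subr_eq0; apply/eqP => e.
have := normc_npow_le_half s1 q1; rewrite -e normc1 => h.
by have : (1 : R) <= 2^-1 by []; lra.
Qed.

Lemma corrected_euler_productE (B : nat -> nat) (s : R[i]) Q :
  corrected_euler_product B s Q = \prod_(2 <= q < Q.+1) (1 - npow q (- s)) ^+ B q *
    cexp (\sum_(2 <= q < Q.+1) log_sum (npow q (- s)) (trunc_log q Q) *+ B q).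
Proof.
rewrite cexp_sum -big_split /corrected_euler_product.
by apply: eq_bigr => q _; rewrite exprMn cexpMn.
Qed.

(** The corrected product for the indicator function of the primes tends to 1, so the exponential
    has the same limit as the partial Euler products of zeta. *)
Lemma cexp_log_sum_primes_cvg (s : R[i]) : 1 < complex.Re s ->
  (fun Q => cexp (\sum_(1 <= p < Q.+1 | prime p) log_sum (npow p (- s)) (trunc_log p Q)) : R[i]^o)
  @ \oo --> (riemann_zeta s : R[i]^o).
Proof.
move=> s1; pose B q : nat := prime q.
have T1 : (corrected_euler_product B s : nat -> R[i]^o) @ \oo --> (1 : R[i]^o).
  apply: (@corrected_euler_product_cvg _ B s 0 1) => // q _.
  by rewrite expr0 mulr1 /B; case: (prime q).
suff -> : (fun Q => cexp (\sum_(1 <= p < Q.+1 | prime p)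
      log_sum (npow p (- s)) (trunc_log p Q))) =
    (fun Q => corrected_euler_product B s Q * (euler_product s Q)^-1).
  exact: (@cvg_mul_cvg1 R[i] _ _ _ T1 (euler_cvg s1)).
apply/funext => Q; rewrite corrected_euler_productE.
have -> : \prod_(2 <= q < Q.+1) (1 - npow q (- s)) ^+ B q = euler_product s Q.
  rewrite /euler_product; case: Q => [|Q]; first by rewrite !big_geq.
  rewrite [RHS]big_ltn_cond// -[prime 1]/false [RHS]big_mkcond; apply: eq_bigr => q _.
  by rewrite /B; case: (prime q); rewrite ?expr1 ?expr0.
have -> : \sum_(2 <= q < Q.+1) log_sum (npow q (- s)) (trunc_log q Q) *+ B q =
    \sum_(1 <= p < Q.+1 | prime p) log_sum (npow p (- s)) (trunc_log p Q).
  case: Q => [|Q]; first by rewrite !big_geq.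
  rewrite [RHS]big_ltn_cond// -[prime 1]/false [RHS]big_mkcond; apply: eq_bigr => q _.
  by rewrite /B; case: (prime q); rewrite ?mulr1n ?mulr0n.
rewrite mulrAC divff ?mul1r//.
rewrite /euler_product prodf_seq_neq0; apply/allP => p _; apply/implyP => pp.
by apply: npow_neq1; [exact: ltW|exact: prime_gt1].
Qed.

(** At each [Q], the product is the quotient by the corrected product of an exponential that factors
    exactly into powers of those attached to the [s - j]. The divisor tends to 1, and nonvanishing
    of zeta allows negative exponents [a j]. *)
Lemma euler_product_zeta_cvg (B : nat -> nat) m (a : 'I_m.+1 -> int) (s : R[i]) :
  (forall q, B q != 0%N -> exists p k, [/\ prime p, (0 < k)%N & q = (p ^ k)%N]) ->
  (forall p k, prime p -> (0 < k)%N ->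
    (\sum_(d <- divisors k) B (p ^ d) * d)%N%:Z =
    \sum_(j < m.+1) a j * ((p ^ k) ^ j)%N%:Z) ->
  m.+1%:R < complex.Re s ->
  (fun Q => \prod_(2 <= q < Q.+1) (1 - npow q (- s)) ^- B q : R[i]^o) @ \oo -->
    (\prod_(j < m.+1) riemann_zeta (s - (j : nat)%:R) ^ a j : R[i]^o).
Proof.
move=> B0 BE sm; have s1 : 1 <= complex.Re s by apply: le_trans (ltW sm); rewrite ler1n.
have sj (j : 'I_m.+1) : 1 < complex.Re (s - (j : nat)%:R).
  have -> : complex.Re (s - (j : nat)%:R) = complex.Re s - (j : nat)%:R.
    by rewrite -(rmorph_nat (real_complex R)); case: (s) => x y /=.
  rewrite ltrBrDl (le_lt_trans _ sm)// -natr1 lerD2r ler_nat.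
  by rewrite -ltnS.
(* [B q] is at most the term [d = k] of the divisor sum for [q = p ^ k], hence at most the value at
   [q] of the polynomial with coefficients [a j]. *)
pose C : R := \sum_(j < m.+1) `|(a j)%:~R|.
have BC q : (1 < q)%N -> (B q)%:R <= C * q%:R ^+ m.
  move=> q1; have [->|/B0[p [k [pp k0 qE]]]] := eqVneq (B q) 0%N.
    by rewrite mulr_ge0 ?exprn_ge0 ?sumr_ge0.
  apply: (@le_trans _ _ (\sum_(d <- divisors k) B (p ^ d) * d)%N%:R).
    rewrite ler_nat (bigD1_seq k) ?divisors_uniq -?dvdn_divisors//= -qE.
    by apply: leq_trans (leq_addr _ _); rewrite leq_pmulr.
  have -> : (\sum_(d <- divisors k) B (p ^ d) * d)%N%:R =
    (\sum_(j < m.+1) a j * ((p ^ k) ^ j)%N%:Z)%:~R :> R by rewrite -BE.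
  rewrite rmorph_sum mulr_suml; apply: ler_sum => j _.
  rewrite rmorphM /= -qE -pmulrn natrX; apply: le_trans (ler_norm _) _.
  rewrite normrM ler_wpM2l// ger0_norm ?exprn_ge0//.
  by rewrite ler_weXn2l ?ler1n ?(ltnW q1)// -ltnS.
have T1 := corrected_euler_product_cvg sm BC.
pose c j Q := cexp (\sum_(1 <= p < Q.+1 | prime p)
  log_sum (npow p (- (s - (j : nat)%:R))) (trunc_log p Q)).
have cj (j : 'I_m.+1) := cexp_log_sum_primes_cvg (sj j).
have zj (j : 'I_m.+1) := zeta_neq0 (sj j).
have cz := @cvg_prod_exprz R[i] m.+1 (fun j => c j) _ a zj cj.
refine (@cvg_div_cvg1 R[i] _ _ _ _ _ T1 cz) => Q; rewrite corrected_euler_productE.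
have zX p k : prime p -> npow (p ^ k) (- s) = npow p (- s) ^+ k.
  by move=> pp; rewrite npowX// prime_gt0.
have E := @log_sum_prime_powers R[i] Q (fun q => npow q (- s)) B m a zX B0 BE.
have -> : \prod_(j < m.+1) c j Q ^ a j =
    cexp (\sum_(2 <= q < Q.+1) log_sum (npow q (- s)) (trunc_log q Q) *+ B q).
  transitivity (cexp (\sum_(j < m.+1) (\sum_(1 <= p < Q.+1 | prime p)
      log_sum (p%:R ^+ j * npow p (- s)) (trunc_log p Q)) *~ a j)); last first.
    exact: (congr1 (@cexp R) (esym E)).
  have e (j : 'I_m.+1) : \sum_(1 <= p < Q.+1 | prime p)
        log_sum (npow p (- (s - (j : nat)%:R))) (trunc_log p Q) =
      \sum_(1 <= p < Q.+1 | prime p) log_sum (p%:R ^+ j * npow p (- s)) (trunc_log p Q).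
    apply: eq_bigr => p pp; rewrite opprB npowD npow_nat ?prime_gt0//.
  by rewrite cexp_sum; apply: eq_bigr => j _; rewrite cexp_intmul /c e.
by rewrite invfM mulrCA mulfV ?cexp_neq0// mulr1 prodfV.
Qed.
End Final.

(** The [a j] are the coefficients of the sum of the [('X - 1) ^ (#|S| - 1)], of degree at most [n]
    as [S] has at most [n] elements; for [q > 0] the truncated [q.-1] is the value of ['X - 1]. *)
Lemma sum_pred_pow_poly n (SS : {set {set 'I_n}}) : exists a : 'I_n.+1 -> int,
  forall q, (0 < q)%N ->
  (\sum_(S in SS | S != finset.set0) q.-1 ^ (#|S|.-1))%N%:Z =
  \sum_(j < n.+1) a j * (q ^ j)%N%:Z.
Proof.
pose P : {poly int} := \sum_(S in SS | S != finset.set0) ('X - 1%:P) ^+ (#|S|.-1).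
have sP : (size P <= n.+1)%N.
  apply: (leq_trans (size_sum _ _ _)); apply/bigmax_leqP => S _.
  rewrite size_exp_XsubC ltnS (leq_trans (leq_pred _))//.
  by rewrite -[X in (_ <= X)%N]card_ord max_card.
exists (fun j => P`_j) => q q0; transitivity P.[q%:Z].
  rewrite horner_sum (big_morph Posz PoszD (erefl _)); apply: eq_bigr => S _.
  by rewrite !hornerE -subn1 -natz natrX natrB// natz.
rewrite (horner_coef_wide _ sP); apply: eq_bigr => j _.
by rewrite -[(q ^ j)%N%:Z]natz natrX natz.
Qed.

Theorem theorem13p1 (R : realType) (G : loose_graph) :
  defined_over_F1 R (loose_scheme G).
Proof.
rewrite loose_scheme_supported.
have [B [BP B0 BE]] := closed_points_count (loose_supports G).
have [a aP] := sum_pred_pow_poly (loose_supports G).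
exists #|cvertex G|, a => s sm; exists B; first exact: BP.
apply: euler_product_zeta_cvg => // p k pp k0.
by rewrite BE// aP// expn_gt0 prime_gt0.
Qed.
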